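(* Let $\alpha\in(0,1)$ and let $n\ge2$ be an integer. Let $\mathcal{E}_0,\mathcal{E}_1:[0,1)\to\mathbb{C}$ satisfy: $\mathcal{E}_0,\mathcal{E}_1\in C([0,1))\cap C^n((0,1))$; $x^\alpha\mathcal{E}_{0x},\,y^\alpha\mathcal{E}_{1y}\in C([0,1))$; $\mathcal{E}_0(0)=\mathcal{E}_1(0)=1$; $\operatorname{Re}\mathcal{E}_0(x)>0$ for $x\in[0,1)$; $\operatorname{Re}\mathcal{E}_1(y)>0$ for $y\in[0,1)$. Let $\mathcal{E}(x,y)$ be a $C^n$-solution of the Goursat problem for the hyperbolic Ernst equation in $D$ with data $\{\mathcal{E}_0,\mathcal{E}_1\}$. Let $m_1,m_2\in\mathbb{C}$ be $$m_1=\lim_{x\downarrow0}x^\alpha\mathcal{E}_{0x}(x),\qquad m_2=\lim_{y\downarrow0}y^\alpha\mathcal{E}_{1y}(y).$$ Then $$\lim_{x\downarrow0}x^\alpha\mathcal{E}_x(x,y)=m_1\frac{e^{i\int_0^y\frac{\operatorname{Im}\mathcal{E}_{1y}(y')}{\operatorname{Re}\mathcal{E}_1(y')}dy'}\operatorname{Re}\mathcal{E}_1(y)}{\sqrt{1-y}}\quad\text{for each }y\in[0,1),$$ $$\lim_{y\downarrow0}y^\alpha\mathcal{E}_y(x,y)=m_2\frac{e^{i\int_0^x\frac{\operatorname{Im}\mathcal{E}_{0x}(x')}{\operatorname{Re}\mathcal{E}_0(x')}dx'}\operatorname{Re}\mathcal{E}_0(x)}{\sqrt{1-x}}\quad\text{for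 each }x\in[0,1).$$ In particular, $$\lim_{x\downarrow0}x^\alpha|\mathcal{E}_x(x,y)|=|m_1|\frac{\operatorname{Re}\mathcal{E}_1(y)}{\sqrt{1-y}}\ \text{ for each }y\in[0,1),\qquad \lim_{y\downarrow0}y^\alpha|\mathcal{E}_y(x,y)|=|m_2|\frac{\operatorname{Re}\mathcal{E}_0(x)}{\sqrt{1-x}}\ \text{ for each }x\in[0,1).$$
   Context: $D=\{(x,y)\in\mathbb{R}^2: x\ge0,\ y\ge0,\ x+y<1\}$, with interior $\operatorname{int}D$. Subscripts $x,y$ denote (partial) derivatives. Conditions such as ''$x^\alpha f_x\in C(S)$'' mean that the function has a continuous extension to $S$. The hyperbolic Ernst equation is $(\operatorname{Re}\mathcal{E})\Big(\mathcal{E}_{xy}-\frac{\mathcal{E}_x+\mathcal{E}_y}{2(1-x-y)}\Big)=\mathcal{E}_x\mathcal{E}_y$. $C^n$-solution: a function $\mathcal{E}:D\to\mathbb{C}$ is a $C^n$-solution of the Goursat problem for the hyperbolic Ernst equation in $D$ with data $\{\mathcal{E}_0,\mathcal{E}_1\}$ if $\mathcal{E}\in C(D)\cap C^n(\operatorname{int}D)$; $\mathcal{E}$ satisfies the equation in $\operatorname{int}D$; $x^\alpha\mathcal{E}_x,\,y^\alpha\mathcal{E}_y,\,x^\alpha y^\alpha\mathcal{E}_{xy}\in C(D)$ for some $\alpha\in[0,1)$; $\mathcal{E}(x,0)=\mathcal{E}_0(x)$ for $x\in[0,1)$; $\mathcal{E}(0,y)=\mathcal{E}_1(y)$ for $y\in[0,1)$;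 and $\operatorname{Re}\mathcal{E}(x,y)>0$ for $(x,y)\in D$. *)

(* Defs.v *)
From HB Require Import structures.
From mathcomp Require Import all_boot all_order all_algebra.
From mathcomp Require Import complex.
From mathcomp Require Import all_classical all_reals all_analysis.
Import Order.TTheory GRing.Theory Num.Theory numFieldNormedType.Exports.

Set Implicit Arguments.
Unset Strict Implicit.
Unset Printing Implicit Defensive.

Local Open Scope classical_set_scope.
Local Open Scope ring_scope.
Local Open Scope complex_scope.

(* The library puts no topology on [R[i]]; this is the one of the modulus. *)
HB.instance Definition _ (R : realType) := NormedModule.copy R[i] (R[i])^o.

Section Defs.
Context {R : realType}.

Definition expi (theta : R) : R[i] := cos theta +i* sin theta.

(* [R[i]] is a normed module over itself but not over [R], so derivatives with
   respect to a real variable are taken componentwise. *)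
Definition cderivable (f : R -> R[i]) (x : R) : Prop :=
  derivable (fun t => complex.Re (f t)) x 1 /\
  derivable (fun t => complex.Im (f t)) x 1.

Definition cderive (f : R -> R[i]) (x : R) : R[i] :=
  derive1 (fun t => complex.Re (f t)) x +i*
  derive1 (fun t => complex.Im (f t)) x.

Definition dx (F : R * R -> R[i]) (p : R * R) : R[i] :=
  cderive (fun t => F (t, p.2)) p.1.

Definition dy (F : R * R -> R[i]) (p : R * R) : R[i] :=
  cderive (fun t => F (p.1, t)) p.2.

(* To be used with [U] open: [cderive], [dx] and [dy] look at a full
   neighbourhood of the point. *)
Fixpoint Cn1 (n : nat) (U : set R) (f : R -> R[i]) : Prop :=
  {within U, continuous f} /\
  if n is m.+1 then
    (forall x, U x -> cderivable f x) /\ Cn1 m U (cderive f)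
  else True.

Fixpoint Cn2 (n : nat) (U : set (R * R)) (F : R * R -> R[i]) : Prop :=
  {within U, continuous F} /\
  if n is m.+1 then
    [/\ forall p, U p -> cderivable (fun t => F (t, p.2)) p.1 /\
                         cderivable (fun t => F (p.1, t)) p.2,
        Cn2 m U (dx F) & Cn2 m U (dy F)]
  else True.

(* [f], regarded as defined on [A] only, extends continuously to [S]. *)
Definition cont_ext {T : topologicalType} (A S : set T) (f : T -> R[i]) : Prop :=
  exists g : T -> R[i],
    {within S, continuous g} /\ (forall p, A p -> g p = f p).

(* Below, powers are only used at points of [D^°] (resp. [`]0, 1[]), where the
   base is positive; the exponent [a] of a solution is its own, not tied to the
   exponent [alpha] of the data. *)
Definition D : set (R * R) :=
  [set p | [/\ 0 <= p.1, 0 <= p.2 & p.1 + p.2 < 1]].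

Definition ernst_eq (E : R * R -> R[i]) (p : R * R) : Prop :=
  (complex.Re (E p))%:C *
    (dy (dx E) p - (dx E p + dy E p) / (2 * (1 - p.1 - p.2))%:C)
  = dx E p * dy E p.

Record is_goursat_solution (n : nat) (E0 E1 : R -> R[i]) (E : R * R -> R[i])
    : Prop := IsGoursatSolution {
  goursat_cont : {within D, continuous E} ;
  goursat_Cn : Cn2 n D^° E ;
  goursat_ernst : forall p, D^° p -> ernst_eq E p ;
  goursat_deriv : exists a : R, [/\ 0 <= a < 1,
      cont_ext D^° D (fun p => (p.1 `^ a)%:C * dx E p),
      cont_ext D^° D (fun p => (p.2 `^ a)%:C * dy E p) &
      cont_ext D^° D
        (fun p => (p.1 `^ a)%:C * (p.2 `^ a)%:C * dy (dx E) p)] ;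
  goursat_x_axis : forall x, 0 <= x < 1 -> E (x, 0) = E0 x ;
  goursat_y_axis : forall y, 0 <= y < 1 -> E (0, y) = E1 y ;
  goursat_Re_gt0 : forall p, D p -> 0 < complex.Re (E p)
}.

Record is_goursat_datum (n : nat) (alpha : R) (f : R -> R[i]) : Prop :=
    IsGoursatDatum {
  datum_cont : {within `[0, 1[, continuous f} ;
  datum_Cn : Cn1 n `]0, 1[ f ;
  datum_deriv :
    cont_ext (T := R) `]0, 1[ `[0, 1[ (fun x => (x `^ alpha)%:C * cderive f x) ;
  datum0 : f 0 = 1 ;
  datum_Re_gt0 : forall x, 0 <= x < 1 -> 0 < complex.Re (f x)
}.

(* A Lebesgue integral: the integrand may be unbounded, of order t^(-alpha),
   near t = 0, and its value at the single point t = 0 is irrelevant. *)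
Definition phase (f : R -> R[i]) (s : R) : R :=
  \int[lebesgue_measure]_(t in `[0, s])
    (complex.Im (cderive f t) / complex.Re (f t)).

End Defs.

(* Main.v *)
(* The Ernst equation is a linear equation in t for u = E_x(x, .):
     u_t = u (1/(2(1-x-t)) + E_t / Re E) + E_t / (2(1-x-t)).
   Put V = x^alpha u sqrt(1-x-t) / Re E.  The weight cancels the real part of
   the coefficient of u, so that V_t = i (Im E_t / Re E) V + O(x^alpha t^(-a)).
   As x -> 0, t^a Im E_t / Re E converges uniformly in t to its value on the
   edge x = 0, where it is t^a times the derivative of [phase E1].  Hence
   Gronwall's inequality with the integrable weight t^(-a) compares V with
   V(x, 0) exp(i phase E1), and V(x, 0) -> m1.  The continuous extensions of
   x^a E_x and y^a E_y are identified on the edges through the mean value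
   theorem.  Exchanging x and y, which Schwarz's theorem permits, gives the
   other limit; the last two follow by taking moduli. *)

Require Import Defs.
From HB Require Import structures.
From mathcomp Require Import all_boot all_order all_algebra.
From mathcomp Require Import ring lra.
From mathcomp Require Import complex.
From mathcomp Require Import all_classical all_reals all_analysis.
From mathcomp Require Import measurable_realfun.
Import Order.TTheory GRing.Theory Num.Theory numFieldNormedType.Exports.

Set Implicit Arguments.
Unset Strict Implicit.
Unset Printing Implicit Defensive.

Local Open Scope classical_set_scope.
Local Open Scope ring_scope.
Local Open Scope complex_scope.

(** * Gronwall and perturbed rotations *)

Section RealAnalysis.
Context {R : realType}.
Implicit Types (a b x y t : R).

(** Two features of the hypotheses shape the argument. The exponent a of the solution is not tied to
    alpha and may exceed it, so the continuous extension of x^a E_x does not by itself give a limit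
    of x^alpha E_x at the edge x = 0; that limit is known only at the corner, from the datum, and
    has to be carried up the lines x = const by estimates uniform in x. Moreover a derivative taken
    at an edge point, such as [dx E (x, 0)], is the derivative of boundary values, and its agreement
    with limits from the interior has to be proved. The source term is harmless for two separate
    reasons: its factor x^alpha vanishes in the limit because alpha > 0, and its growth t^(-a) is
    integrable because a < 1. The rate of rotation Im E_t / Re E may itself be unbounded near t = 0,
    but a rotation preserves lengths, so only its distance to the limiting rate enters the error.
    The complex quantity V is handled as a pair of real functions throughout. *)

Lemma is_derive1_add (f g : R -> R) t (df dg : R) :
  is_derive t 1 f df -> is_derive t 1 g dg ->
  is_derive t 1 (fun s => f s + g s) (df + dg).
Proof. by move=> fd gd; exact: (is_deriveD (f := f) (g := g)). Qed.

Lemma is_derive1_sub (f g : R -> R) t (df dg : R) :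
  is_derive t 1 f df -> is_derive t 1 g dg ->
  is_derive t 1 (fun s => f s - g s) (df - dg).
Proof. by move=> fd gd; exact: (is_deriveB (f := f) (g := g)). Qed.

Lemma is_derive1_mul (f g : R -> R) t (df dg : R) :
  is_derive t 1 f df -> is_derive t 1 g dg ->
  is_derive t 1 (fun s => f s * g s) (df * g t + f t * dg).
Proof.
move=> fd gd; apply: (is_derive_eq (is_deriveM (f := f) (g := g) fd gd)).
by rewrite /GRing.scale/=; ring.
Qed.

Lemma is_derive1_scale (k : R) (f : R -> R) t (df : R) :
  is_derive t 1 f df -> is_derive t 1 (fun s => k * f s) (k * df).
Proof. by move=> fd; exact: (is_deriveZ (f := f) k). Qed.

Lemma is_derive_powR_prim a t : a < 1 -> 0 < t ->
  is_derive t 1 (fun s => s `^ (1 - a) / (1 - a)) (t `^ (- a)).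
Proof.
move=> a1 t0; rewrite [X in is_derive _ _ X](_ : _ =
   (fun s => (1 - a)^-1 * (s `^ (1 - a)))); last first.
  by apply/funext => s; rewrite mulrC.
apply: (is_derive_eq (is_derive1_scale _ (is_derive1_powR _ t0))).
rewrite mulrA mulVf ?mul1r; last by rewrite subr_eq0 gt_eqF.
by congr (_ `^ _); ring.
Qed.

Lemma powR_continuous_gt0 (b t : R) :
  0 < t -> {for t, continuous (fun s : R => s `^ b)}.
Proof.
move=> t0; apply: differentiable_continuous; apply/derivable1_diffP.
by apply: derivable_powR; rewrite in_itv/= andbT.
Qed.

Lemma powR_continuous_ge0 a (b : R) : 0 < b -> 0 <= a ->
  {within `[0, a], continuous (fun s : R => s `^ b)}.
Proof.
move=> b0; rewrite le_eqVlt => /predU1P[<-|a0].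
  by rewrite set_itv1; exact: continuous_subspace1.
apply/continuous_within_itvP => //; split.
- by move=> t; rewrite in_itv/= => /andP[t0 _]; exact: powR_continuous_gt0.
- by rewrite powR0 ?gt_eqF//; exact: powR_cvg0.
- exact/cvg_at_left_filter/powR_continuous_gt0.
Qed.

(** With [P] the primitive t^(1-a)/(1-a) of the weight, q exp(-k P) is nonincreasing. Since a < 1,
    [P] is continuous at 0 with value 0, so the singularity of the weight costs nothing and the
    differential inequality is asked for in the open interval only. *)
Lemma gronwall_powR a (k y : R) (q dq : R -> R) : a < 1 -> 0 < y ->
  {within `[0, y], continuous q} ->
  (forall t, 0 < t < y -> is_derive t 1 q (dq t)) ->
  (forall t, 0 < t < y -> dq t <= k * t `^ (- a) * q t) ->
  q y <= q 0 * expR (k * (y `^ (1 - a) / (1 - a))).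
Proof.
move=> a1 y0 qc qd qle.
pose P := fun s : R => s `^ (1 - a) / (1 - a).
pose h := fun s => q s * expR (- k * P s).
pose dh := fun t => dq t * expR (- k * P t) + q t * (expR (- k * P t) * (- k * t `^ (- a))).
have hd t : 0 < t < y -> is_derive t 1 h (dh t).
  move=> t0y; have dqt := qd _ t0y; have /andP[t0 ty] := t0y.
  have dP := is_derive_powR_prim a1 t0.
  have dE : is_derive t 1 (fun s => expR (- k * P s))
      (expR (- k * P t) * (- k * t `^ (- a))).
    have dkP : is_derive t 1 (fun s => - k * P s) (- k * t `^ (- a)).
      exact: is_derive1_scale.
    exact: (@is_derive1_comp _ expR (fun s => - k * P s) t _ _ _ dkP).
  exact: is_derive1_mul.
have hc : {within `[0, y], continuous h}.
  apply/subspace_continuousP => t tA; apply: cvgM.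
    by move/subspace_continuousP : qc; exact.
  apply: (@cvg_comp _ _ _ (fun s => - k * P s) expR _ _ _ _ (@continuous_expR R _)).
  apply: cvgMl_tmp; apply: cvgMr_tmp.
  have /subspace_continuousP : {within `[0, y], continuous (fun s : R => s `^ (1 - a))}.
    by apply: powR_continuous_ge0; rewrite ?subr_gt0 ?ltW.
  exact.
have hle : h y <= h 0.
  apply: (@ler0_derive1_le_cc _ h 0 y) => //.
  - move=> t; rewrite in_itv/= => /hd dt; exact: ex_derive.
  - move=> t; rewrite in_itv/= => t0y; rewrite derive1E.
    have dht := hd _ t0y; rewrite derive_val /dh.
    have -> : dq t * expR (- k * P t) + q t * (expR (- k * P t) * (- k * t `^ (- a)))
      = expR (- k * P t) * (dq t - k * t `^ (- a) * q t) by ring.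
    rewrite pmulr_rle0 ?expR_gt0// subr_le0; exact: qle.
  - by rewrite in_itv/= lexx ltW.
  - by rewrite in_itv/= lexx ltW.
  - exact: ltW.
move: hle; rewrite /h {2}/P powR0 ?subr_eq0 ?gt_eqF// mul0r mulr0 expR0 mulr1.
by rewrite mulNr expRN ler_pdivrMr ?expR_gt0.
Qed.

End RealAnalysis.

Section Rotation.
Context {R : realType}.

Lemma double_prod_le (d A k : R) : `|A| <= k -> 2 * d * A <= k * (d ^+ 2 + 1).
Proof.
rewrite ler_norml => /andP[A1 A2].
(* The two left-hand products add up to 2k(d^2 + 1) - 4dA. *)
have h1 : 0 <= (k + A) * (d - 1) ^+ 2 by rewrite mulr_ge0 ?sqr_ge0//; lra.
have h2 : 0 <= (k - A) * (d + 1) ^+ 2 by rewrite mulr_ge0 ?sqr_ge0//; lra.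
nra.
Qed.

Lemma norm_rotation_le (c1 c2 M s : R) : `|c1| <= M -> `|c2| <= M ->
  `|c1 * cos s - c2 * sin s| <= 2 * M /\ `|c1 * sin s + c2 * cos s| <= 2 * M.
Proof.
move=> c1M c2M.
have hc : `|cos s| <= 1 by rewrite ler_norml cos_geN1 cos_le1.
have hs : `|sin s| <= 1 by rewrite ler_norml sin_geN1 sin_le1.
have H (u v : R) : `|u| <= M -> `|v| <= 1 -> `|u * v| <= M.
  by move=> uM v1; rewrite normrM (le_trans (ler_piMr _ v1)).
split.
  rewrite (le_trans (ler_normB _ _))// mulr_natl mulr2n lerD//; exact: H.
rewrite (le_trans (ler_normD _ _))// mulr_natl mulr2n lerD//; exact: H.
Qed.

(** In complex notation V = v1 + i v2 solves V' = i ph V + F, and Z = V(0) exp(i th) solves Z' = i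
    dth Z. The difference d = V - Z satisfies d' = i ph d + F + i (ph - dth) Z. The first term is
    orthogonal to d, so |d|^2 grows only through the other two, each small against t^(-a). Gronwall
    is applied to |d|^2 + 1, which starts at 1; hence the bound of the form exp - 1. *)
Lemma rotation_perturbation (a e M y : R) (v1 v2 th dth ph F1 F2 : R -> R) :
  a < 1 -> 0 < y -> 0 <= M ->
  {within `[0, y], continuous v1} -> {within `[0, y], continuous v2} ->
  {within `[0, y], continuous th} -> th 0 = 0 ->
  (forall t, 0 < t < y -> is_derive t 1 v1 (F1 t - ph t * v2 t)) ->
  (forall t, 0 < t < y -> is_derive t 1 v2 (F2 t + ph t * v1 t)) ->
  (forall t, 0 < t < y -> is_derive t 1 th (dth t)) ->
  (forall t, 0 < t < y -> `|ph t - dth t| <= e * t `^ (- a)) ->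
  (forall t, 0 < t < y -> `|F1 t| <= e * t `^ (- a)) ->
  (forall t, 0 < t < y -> `|F2 t| <= e * t `^ (- a)) ->
  `|v1 0| <= M -> `|v2 0| <= M ->
  (v1 y - (v1 0 * cos (th y) - v2 0 * sin (th y))) ^+ 2 +
  (v2 y - (v1 0 * sin (th y) + v2 0 * cos (th y))) ^+ 2 <=
  expR (2 * (2 * M + 1) * e * (y `^ (1 - a) / (1 - a))) - 1.
Proof.
move=> a1 y0 M0 cv1 cv2 cth th0 dv1 dv2 dth_ phe F1e F2e v1M v2M.
pose z1 t := v1 0 * cos (th t) - v2 0 * sin (th t).
pose z2 t := v1 0 * sin (th t) + v2 0 * cos (th t).
pose d1 t := v1 t - z1 t; pose d2 t := v2 t - z2 t.
(* The summand 1 absorbs the terms of the derivative linear in [d1] and [d2]. *)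
pose q t := d1 t * d1 t + d2 t * d2 t + 1.
have qE t : q t = (d1 t) ^+ 2 + (d2 t) ^+ 2 + 1 by rewrite /q; ring.
pose d1' t := F1 t - ph t * v2 t - - (z2 t * dth t).
pose d2' t := F2 t + ph t * v1 t - (z1 t * dth t).
have dcos t : 0 < t < y ->
    is_derive t 1 (fun s => cos (th s)) (- sin (th t) * dth t).
  by move=> ty; have dt := dth_ _ ty; exact: (is_derive1_comp (f := cos) (g := th)).
have dsin t : 0 < t < y ->
    is_derive t 1 (fun s => sin (th s)) (cos (th t) * dth t).
  by move=> ty; have dt := dth_ _ ty; exact: (is_derive1_comp (f := sin) (g := th)).
have dd1 t : 0 < t < y -> is_derive t 1 d1 (d1' t).
  move=> ty; apply: is_derive1_sub; first exact: dv1.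
  apply: is_derive_eq.
    apply: is_derive1_sub; apply: is_derive1_scale; [exact: dcos|exact: dsin].
  by rewrite /z2; ring.
have dd2 t : 0 < t < y -> is_derive t 1 d2 (d2' t).
  move=> ty; apply: is_derive1_sub; first exact: dv2.
  apply: is_derive_eq.
    apply: is_derive1_add; apply: is_derive1_scale; [exact: dsin|exact: dcos].
  by rewrite /z1; ring.
have dq t : 0 < t < y ->
    is_derive t 1 q (2 * d1 t * d1' t + 2 * d2 t * d2' t).
  move=> ty; have h1 := dd1 _ ty; have h2 := dd2 _ ty.
  have /is_derive_eq := is_derive1_add (is_derive1_add (is_derive1_mul h1 h1)
    (is_derive1_mul h2 h2)) (is_derive_cst (1 : R) t 1).
  by apply; ring.
have ctrig (f : R -> R) : continuous f -> {within `[0, y], continuous (f \o th)}.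
  move=> cf; apply/subspace_continuousP => t tA.
  apply: (@cvg_comp _ _ _ th f _ _ _ _ (cf _)).
  by move/subspace_continuousP : cth; exact.
have cq : {within `[0, y], continuous q}.
  apply/subspace_continuousP => t tA.
  have /subspace_continuousP/(_ t tA) h1 := cv1.
  have /subspace_continuousP/(_ t tA) h2 := cv2.
  have /subspace_continuousP/(_ t tA) h3 := ctrig _ (@continuous_cos R).
  have /subspace_continuousP/(_ t tA) h4 := ctrig _ (@continuous_sin R).
  have k1 : d1 s @[s --> within `[0, y] (nbhs t)] --> d1 t.
    by apply: cvgB => //; apply: cvgB; apply: cvgMl_tmp.
  have k2 : d2 s @[s --> within `[0, y] (nbhs t)] --> d2 t.
    by apply: cvgB => //; apply: cvgD; apply: cvgMl_tmp.
  apply: cvgD; last exact: cvg_cst.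
  by apply: cvgD; apply: cvgM.
have dqle t : 0 < t < y -> 2 * d1 t * d1' t + 2 * d2 t * d2' t <=
    2 * (2 * M + 1) * e * t `^ (- a) * q t.
  move=> ty; have [z1M z2M] := norm_rotation_le (th t) v1M v2M.
  have {}phe := phe _ ty; have {}F1e := F1e _ ty; have {}F2e := F2e _ ty.
  set E := e * t `^ (- a) in phe F1e F2e.
  have E0 : 0 <= E by exact: le_trans F1e.
  (* Each coordinate of Z is at most 2M in absolute value, which gives 2M E for the mismatch of the
     rates; the source adds one more E. *)
  set k := (2 * M + 1) * E.
  have B (z : R) : `|z| <= 2 * M -> `|z * (ph t - dth t)| <= 2 * M * E.
    by move=> zM; rewrite normrM ler_pM.
  have A1 : `|F1 t - z2 t * (ph t - dth t)| <= k.
    rewrite (le_trans (ler_normB _ _))// (_ : k = E + 2 * M * E) ?lerD ?B//; rewrite /k; ring.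
  have A2 : `|F2 t + z1 t * (ph t - dth t)| <= k.
    rewrite (le_trans (ler_normD _ _))// (_ : k = E + 2 * M * E) ?lerD ?B//; rewrite /k; ring.
  (* The contributions - ph d1 d2 and + ph d2 d1 cancel here, which is why no bound on [ph] alone is
     required. *)
  have -> : 2 * d1 t * d1' t + 2 * d2 t * d2' t =
    2 * d1 t * (F1 t - z2 t * (ph t - dth t)) +
    2 * d2 t * (F2 t + z1 t * (ph t - dth t)).
    by rewrite /d1' /d2' /d1 /d2; ring.
  apply: (le_trans (lerD (double_prod_le _ A1) (double_prod_le _ A2))).
  have -> : 2 * (2 * M + 1) * e * t `^ (- a) * q t = 2 * k * q t.
    by rewrite /k /E; ring.
  have k0 : 0 <= k by exact: le_trans A1.
  rewrite qE; nra.
have /= := gronwall_powR a1 y0 cq dq dqle.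
have -> : q 0 = 1 by rewrite qE /d1 /d2 /z1 /z2 th0 cos0 sin0; ring.
by rewrite mul1r qE lerBrDr.
Qed.

End Rotation.

(** * Mean value arguments in two variables *)

Section TwoVariables.
Context {R : realType}.

Lemma MVT_derive (g dg : R -> R) (a b : R) : a < b ->
  (forall s, a <= s <= b -> is_derive s 1 g (dg s)) ->
  exists2 c, a <= c <= b & g b - g a = dg c * (b - a).
Proof.
move=> ab dg_.
have [c cab gE] : exists2 c, c \in `]a, b[%R & g b - g a = dg c * (b - a).
  apply: MVT => //.
    by move=> s; rewrite in_itv/= => /andP[as_ sb]; apply: dg_; rewrite !ltW.
  apply: derivable_within_continuous => s; rewrite in_itv/= => sab.
  have ds := dg_ _ sab; exact: ex_derive.
by exists c => //; move: cab; rewrite in_itv/= => /andP[ac cb]; rewrite !ltW.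
Qed.

(* For both orders of differentiation the mean value is that of the same
   second difference, which proves Schwarz's theorem. *)
Lemma second_difference (f fx fxy : R * R -> R) (x y h : R) : 0 < h ->
  (forall s t, x <= s <= x + h -> y <= t <= y + h ->
    is_derive s 1 (fun s' => f (s', t)) (fx (s, t)) /\
    is_derive t 1 (fun t' => fx (s, t')) (fxy (s, t))) ->
  exists s t, [/\ x <= s <= x + h, y <= t <= y + h &
    f (x + h, y + h) - f (x + h, y) - f (x, y + h) + f (x, y) =
      fxy (s, t) * h * h].
Proof.
move=> h0 df.
have xh : x < x + h by rewrite ltrDl.
have yh : y < y + h by rewrite ltrDl.
have [s sx sE] := MVT_derive xh (fun s sx => is_derive1_sub
  (df s (y + h) sx ltac:(by rewrite lexx ltW)).1
  (df s y sx ltac:(by rewrite lexx ltW)).1).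
have [t ty tE] := MVT_derive yh (fun t ty => (df s t sx ty).2).
exists s, t; split => //.
move: sE tE; rewrite !(addrC _ h) !addrK => sE tE.
by rewrite -tE -sE; ring.
Qed.

Lemma schwarz (f fx fy fxy fyx : R * R -> R) (p : R * R) :
  (\forall q \near p, is_derive (q : R * R).1 1 (fun s => f (s, q.2)) (fx q)) ->
  (\forall q \near p, is_derive (q : R * R).2 1 (fun t => f (q.1, t)) (fy q)) ->
  (\forall q \near p, is_derive (q : R * R).2 1 (fun t => fx (q.1, t)) (fxy q)) ->
  (\forall q \near p, is_derive (q : R * R).1 1 (fun s => fy (s, q.2)) (fyx q)) ->
  {for p, continuous fxy} -> {for p, continuous fyx} -> fxy p = fyx p.
Proof.
case: p => x y dfx dfy dfxy dfyx cxy cyx.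
apply/eqP; rewrite -subr_eq0 -normr_le0; apply/ler_addgt0Pr => e e0; rewrite add0r.
have e2 : 0 < e / 2 by rewrite divr_gt0.
have /cvgrPdist_le/(_ _ e2) cxy' := cxy.
have /cvgrPdist_le/(_ _ e2) cyx' := cyx.
have /nbhs_ballP[d /= d0 dP] : \forall q \near (x, y),
    is_derive (q : R * R).1 1 (fun s => f (s, q.2)) (fx q) /\
    is_derive q.2 1 (fun t => f (q.1, t)) (fy q) /\
    is_derive q.2 1 (fun t => fx (q.1, t)) (fxy q) /\
    is_derive q.1 1 (fun s => fy (s, q.2)) (fyx q) /\
    `|fxy (x, y) - fxy q| <= e / 2 /\ `|fyx (x, y) - fyx q| <= e / 2.
  by do 5![apply: filterI => //].
pose h := d / 2.
have h0 : 0 < h by rewrite divr_gt0.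
have inball s t : x <= s <= x + h -> y <= t <= y + h -> ball (x, y) d (s, t).
  move=> /andP[xs sx] /andP[yt ty]; split => /=;
  rewrite /ball/= ler0_norm ?subr_le0// opprB ltrBlDl;
    [apply: (le_lt_trans sx)|apply: (le_lt_trans ty)]; rewrite ltrD2l /h; lra.
have [s [t [sx ty E1]]] := @second_difference f fx fxy x y h h0 (fun s t sx ty =>
  let H := dP _ (inball s t sx ty) in conj H.1 H.2.2.1).
(* With the coordinates exchanged the second difference is unchanged, but it is now a value of
   [fyx]. *)
have [t' [s' [ty' sx' E2]]] := @second_difference (fun q => f (q.2, q.1))
  (fun q => fy (q.2, q.1)) (fun q => fyx (q.2, q.1)) y x h h0 (fun t s ty sx =>
  let H := dP _ (inball s t sx ty) in conj H.2.1 H.2.2.2.1).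
have {E1 E2} E : fxy (s, t) = fyx (s', t').
  apply: (mulIf (lt0r_neq0 h0)); apply: (mulIf (lt0r_neq0 h0)).
  by rewrite -E1 -E2 /=; ring.
have [_ [_ [_ [_ [D1 _]]]]] := dP _ (inball _ _ sx ty).
have [_ [_ [_ [_ [_ D2]]]]] := dP _ (inball _ _ sx' ty').
rewrite (_ : fxy (x, y) - fyx (x, y) = (fxy (x, y) - fxy (s, t)) -
  (fyx (x, y) - fyx (s', t'))); last by rewrite E; ring.
rewrite (splitr e) (le_trans (ler_normB _ _))// lerD//.
Qed.

End TwoVariables.

(** * Uniform convergence to the edge x = 0 *)

Section EdgeUniform.
Context {R : realType}.
Implicit Types (h H : R * R -> R).

Lemma is_derive1_cvg (f : R -> R) (x l : R) :
  (fun d => d^-1 * (f (x + d) - f x)) @ 0^' --> l -> is_derive x 1 f l.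
Proof.
move=> fl.
have fl' : (fun d => d^-1 *: (f (d *: 1 + x) - f x)) @ 0^' --> l.
  apply: cvg_trans fl; apply: near_eq_cvg; near=> d.
  by rewrite /= /GRing.scale/= mulr1 (addrC x).
apply: DeriveDef; first by apply/cvg_ex; exists l.
exact/cvg_lim.
Unshelve. all: by end_near. Qed.

Lemma within_cvg (T U : topologicalType) (A : set T) (f : T -> U) (p : T) :
  {within A, continuous f} -> A p -> f q @[q --> within A (nbhs p)] --> f p.
Proof. by move/subspace_continuousP; exact. Qed.

(** Compactness of the segment from (0, 0) to (0, y), which lies in [D] because y < 1, upgrades
    continuity at its points to uniformity. *)
Lemma D_edge_uniform H (y e : R) : {within D, continuous H} ->
  y < 1 -> 0 < e ->
  \forall x \near 0^'+, forall t, 0 <= t <= y -> `|H (x, t) - H (0, t)| <= e.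
Proof.
move=> cH y1 e0.
have cpt : compact `[0, y] by exact: segment_compact.
have /near_covering_withinP/(_ _ (0:R)^'+
   (fun x t => `|H (x, t) - H (0, t)| <= e)) := (compact_near_coveringP _).1 cpt.
move=> near_cov.
have : \forall x \near (0:R)^'+, `[0, y] `<=` (fun t => `|H (x, t) - H (0, t)| <= e).
  apply: near_cov => t; rewrite /= in_itv/= => /andP[t0 ty].
  have Dt : D (0, t) by split => //=; rewrite add0r (le_lt_trans ty).
  have /cvgrPdist_le/(_ _ (divr_gt0 e0 (ltr0Sn R 1))) := within_cvg cH Dt.
  rewrite near_withinE => -[[/= A B] [/= A0 Bt] AB].
  have t1 : t < 1 by exact: le_lt_trans ty _.
  have d0 : 0 < (1 - t) / 2 by rewrite divr_gt0// subr_gt0.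
  (* The margin 1 - t is shared equally between the two coordinates, so that x + t' < 1 and the
     point stays in [D]. *)
  exists (B `&` [set t' | t' < t + (1 - t) / 2], A `&` [set x | 0 < x < (1 - t) / 2]).
    split => /=.
      apply: filterI => //; apply: lt_nbhsl; lra.
    apply: filterI; first exact: cvg_within.
    near=> x; apply/andP; split; near: x; first exact: nbhs_right_gt.
    exact: nbhs_right_lt.
  move=> [t' x] /= [[Bt' t't] [Ax /andP[x0 xt]]]; rewrite in_itv/= => /andP[t'0 t'y].
  have D1 : D (x, t') by split => /=; [exact: ltW|done|lra].
  have D2 : D (0, t') by split => //=; lra.
  have h1 := AB (x, t') (conj Ax Bt') D1.
  have h2 := AB (0, t') (conj (nbhs_singleton A0) Bt') D2.
  rewrite (_ : H (x, t') - H (0, t') = (H (0, t) - H (0, t')) - (H (0, t) - H (x, t')));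
    last by ring.
  by rewrite (le_trans (ler_normB _ _))// [leRHS]splitr lerD.
by apply: filterS => x xP t ty; apply: xP; rewrite /= in_itv.
Unshelve. all: by end_near. Qed.

Lemma within_D_vertical_cvg H (x : R) : {within D, continuous H} -> 0 <= x < 1 ->
  H (x, t) @[t --> 0^'+] --> H (x, 0).
Proof.
move=> cH /andP[x0 x1].
have Dx : D (x, 0) by split => //=; rewrite addr0.
apply: (@cvg_comp _ _ _ (fun t => (x, t)) H _ _ _ _ (within_cvg cH Dx)).
move=> A /= -[[B C] [/= Bx C0] BC].
near=> t; apply: BC => /=.
  by split => /=; [exact: nbhs_singleton|by near: t; exact: cvg_within].
split => //=; rewrite -ltrBrDl; near: t; apply: nbhs_right_lt; by rewrite subr_gt0.
Unshelve. all: by end_near. Qed.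

End EdgeUniform.

(** * Derivatives along an edge *)

Section EdgeDerivative.
Context {R : realType}.
Implicit Types (h H : R * R -> R).

Lemma lipschitz_derive (g dg : R -> R) (x r e d : R) :
  (forall s, `|s - x| < r -> is_derive s 1 g (dg s) /\ `|dg s| <= e) ->
  `|d| < r -> `|g (x + d) - g x| <= e * `|d|.
Proof.
move=> gP; rewrite ltr_norml => /andP[rd dr].
have [d0|d0|->] := ltgtP d 0; last by rewrite addr0 subrr !normr0 mulr0.
- have xd : x + d < x by lra.
  have xr s : x + d <= s <= x -> `|s - x| < r.
    by move=> /andP[s1 s2]; rewrite ltr_norml; apply/andP; split; lra.
  have [c /xr/gP[_ ce] gE] := MVT_derive xd (fun s sx => (gP s (xr s sx)).1).
  rewrite distrC gE normrM (_ : x - (x + d) = - d); last by ring.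
  by rewrite normrN ler_wpM2r.
- have xd : x < x + d by lra.
  have xr s : x <= s <= x + d -> `|s - x| < r.
    by move=> /andP[s1 s2]; rewrite ltr_norml; apply/andP; split; lra.
  have [c /xr/gP[_ ce] gE] := MVT_derive xd (fun s sx => (gP s (xr s sx)).1).
  rewrite gE normrM (_ : x + d - x = d); last by ring.
  by rewrite ler_wpM2r.
Qed.

(** Near (x, 0) the interior derivative [hx] is within e of L, so on each line t = const > 0 close
    to the edge the function h(s, t) - L s is e-Lipschitz in s near x. This bound does not depend on
    t and passes to the limit t -> 0 by continuity of [h], although no derivative on the edge is
    assumed to exist. *)
Lemma edge_is_derive (a x : R) h H (hx : R * R -> R) : 0 < x < 1 ->
  {within D, continuous h} -> {within D, continuous H} ->
  (forall s t : R, 0 < s -> 0 < t -> s + t < 1 ->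
    is_derive s 1 (fun s' => h (s', t)) (hx (s, t)) /\
    H (s, t) = s `^ a * hx (s, t)) ->
  is_derive x 1 (fun s => h (s, 0)) (H (x, 0) / x `^ a).
Proof.
move=> /andP[x0 x1] ch cH hP.
set L := H (x, 0) / x `^ a.
have Dx : D (x, 0) by split => /=; rewrite ?addr0 ?lexx ?(ltW x0).
have cK : (H q / q.1 `^ a) @[q --> within D (nbhs (x, 0))] --> L.
  apply: cvgM; first exact: (within_cvg cH Dx).
  apply: cvgV; first by rewrite gt_eqF// powR_gt0.
  apply: (@cvg_comp _ _ _ fst (fun s => s `^ a)).
    by apply: cvg_within_filter; exact: cvg_fst.
  exact: powR_continuous_gt0.
apply: is_derive1_cvg; apply/cvgrPdist_le => /= e e0.
have /cvgrPdist_le/(_ _ e0) := cK.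
move=> /(@nbhs_ballP R (R * R)%type (x, 0)) [r /= r0 rP].
(* For |s - x| and t below [d0]: [r] keeps (s, t) in the ball where the extension is close to L, [x]
   keeps s positive, and (1 - x)/2 keeps s + t below 1. *)
pose d0 := Num.min r (Num.min x ((1 - x) / 2)).
have d00 : 0 < d0.
  by rewrite !lt_min r0 x0 divr_gt0 // subr_gt0.
have close s t : `|s - x| < d0 -> 0 < t < d0 ->
    [/\ 0 < s, s + t < 1 & `|L - hx (s, t)| <= e].
  rewrite ltr_norml !lt_min => /andP[s1 /and3P[s2 s3 s4]] /and3P[t0 t1 /andP[t2 t3]].
  have d0x : d0 <= x by rewrite /d0 !ge_min lexx !orbT.
  have d0r : d0 <= r by rewrite /d0 !ge_min lexx.
  have sp : 0 < s by lra.
  have st : s + t < 1 by lra.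
  split => //.
  have := rP (s, t); rewrite (hP s t sp t0 st).2 /= mulrAC mulfV ?gt_eqF ?powR_gt0// mul1r.
  apply; last by split => /=; lra.
  split; rewrite /ball/= ltr_norml; apply/andP; split => /=; lra.
have bound d : `|d| < d0 -> `|h (x + d, 0) - h (x, 0) - L * d| <= e * `|d|.
  move=> dd0.
  have xd : 0 <= x + d < 1.
    move: dd0; rewrite ltr_norml !lt_min => /andP[s1 /and3P[s2 s3 s4]].
    have d0x : d0 <= x by rewrite /d0 !ge_min lexx !orbT.
    by apply/andP; split; lra.
  have xx : 0 <= x < 1 by rewrite ltW.
  have cv : `|h (x + d, t) - h (x, t) - L * d| @[t --> 0^'+] -->
      `|h (x + d, 0) - h (x, 0) - L * d|.
    apply: cvg_norm; apply: cvgB; last exact: cvg_cst.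
    by apply: cvgB; exact: within_D_vertical_cvg.
  apply: (cvgr_to_le cv).
  near=> t.
  have t0 : 0 < t by near: t; exact: nbhs_right_gt.
  have td : t < d0 by near: t; exact: nbhs_right_lt.
  have := @lipschitz_derive (fun s : R => h (s, t) - L * s)
    (fun s => hx (s, t) - L * 1) x d0 e d.
  rewrite (_ : h (x + d, t) - L * (x + d) - (h (x, t) - L * x) =
    h (x + d, t) - h (x, t) - L * d); last by ring.
  apply => // s sx; have [s0 st sL] := close s t sx (introT andP (conj t0 td)).
  split; last by rewrite mulr1 distrC.
  apply: is_derive1_sub; first exact: (hP s t s0 t0 st).1.
  exact: is_derive1_scale.
have : \forall d \near (0 : R)^', `|d| < d0 /\ d != 0.
  near=> d; split; near: d; first exact: dnbhs0_lt.
  exact: nbhs_dnbhs_neq.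
apply: filterS => d [dd dn0].
have -> : L - d^-1 * (h (x + d, 0) - h (x, 0)) =
    - d^-1 * (h (x + d, 0) - h (x, 0) - L * d) by field.
rewrite normrM normrN normfV ler_pdivrMl ?normr_gt0// [leRHS]mulrC; exact: bound.
Unshelve. all: by end_near. Qed.

End EdgeDerivative.

(** * The phase *)

Section Phase.
Context {R : realType}.
Notation mu := (@lebesgue_measure R).

(** Monotone convergence along the intervals [1/(n+1), y]: on each the integral is P(y) -
    P(1/(n+1)), at most P(y). *)
Lemma integral_powR_near0_lty (a y : R) : a < 1 -> 0 < y ->
  (\int[mu]_(t in `]0%R, y]) (t `^ (- a))%:E < +oo)%E.
Proof.
move=> a1 y0; rewrite itv_open_bnd_bigcup.
pose P (s : R) := s `^ (1 - a) / (1 - a).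
pose F n := `[0 + n.+1%:R^-1, y]%classic : set R.
have cvgF : (\int[mu]_(t in F n) (t `^ (- a))%:E)%E @[n --> \oo] -->
    (\int[mu]_(t in \bigcup_n F n) (t `^ (- a))%:E)%E.
  apply: ge0_nondecreasing_set_cvg_integral.
  - move=> n m nm; apply/subsetPset; apply: subset_itvr.
    by rewrite bnd_simp lerD2l lef_pV2 ?posrE// ler_nat.
  - by move=> n; exact: measurable_itv.
  - move=> n; apply/measurable_EFinP.
    by apply: (measurable_funS measurableT) => //; exact: measurable_powR.
  - by move=> n t _; rewrite lee_fin powR_ge0.
apply: le_lt_trans (ltry (P y)).
apply: cvge_to_le cvgF _; apply: nearW => n; rewrite /F add0r.
have n0 : 0 < (n.+1%:R : R)^-1 by rewrite invr_gt0.
have P0 s : 0 <= P s.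
  by rewrite /P divr_ge0// ?powR_ge0// subr_ge0 ltW.
(* For small n the interval may be empty or a single point, and the integral is then 0. *)
have [ny|yn] := ltP (n.+1%:R^-1 : R) y; last first.
  move: yn; rewrite le_eqVlt => /predU1P[->|yn].
    by rewrite set_itv1 integral_set1 lee_fin.
  by rewrite set_itv_ge ?integral_set0 ?lee_fin// -leNgt.
have dP (s : R) : 0 < s -> is_derive s 1 P (s `^ (- a)) by exact: is_derive_powR_prim.
have cP (s : R) : 0 < s -> {for s, continuous P}.
  move=> s0; apply: differentiable_continuous; apply/derivable1_diffP.
  have ds := dP _ s0; exact: ex_derive.
rewrite (@continuous_FTC2 _ _ P)//.
- by rewrite lee_fin gerBl.
- apply: continuous_in_subspaceT => s; rewrite inE/= in_itv/= => /andP[ns _].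
  by apply: powR_continuous_gt0; exact: lt_le_trans ns.
- split.
  + move=> s; rewrite in_itv/= => /andP[ns _].
    by have ds := dP _ (lt_trans n0 ns); exact: ex_derive.
  + by apply: cvg_at_right_filter; exact: cP.
  + by apply: cvg_at_left_filter; exact: cP.
- move=> s; rewrite in_itv/= => /andP[ns _].
  by have ds := dP _ (lt_trans n0 ns); rewrite derive1E derive_val.
Qed.

(** On ]0, y] the integrand is dominated by max |k| times t^(-a), hence is integrable on [0, y], and
    the fundamental theorem of calculus applies at every t > 0, where [f] is continuous. With f = Im
    E1' / Re E1 the function [F] is [phase E1]. *)
Lemma parameterized_integral_powR (a y : R) (f k : R -> R) :
  a < 1 -> 0 < y < 1 ->
  {within `[0, 1[, continuous k} ->
  (forall t, 0 < t < 1 -> k t = t `^ a * f t) ->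
  let F s := \int[mu]_(t in `[0, s]) f t in
  [/\ F 0 = 0, {within `[0, y], continuous F} &
   forall t, 0 < t < y -> is_derive t 1 F (f t)].
Proof.
move=> a1 /andP[y0 y1] ck kE F.
have fE t : 0 < t < 1 -> f t = k t * t `^ (- a).
  move=> /[dup] /andP[t0 _] /kE ->.
  by rewrite powRN mulrAC mulfV ?mul1r// gt_eqF// powR_gt0.
have ck1 : {in `]0, 1[, continuous k}.
  have : {in `]0, 1[%classic, continuous k}.
    rewrite -continuous_open_subspace//.
    by apply: continuous_subspaceW ck; exact: subset_itvW.
  by move=> + t t01; apply; rewrite inE.
have cf : {in `]0, 1[, continuous f}.
  move=> t t01; have /andP[t0 t1] : 0 < t < 1 by move: t01; rewrite in_itv.
  have ckt : {for t, continuous (fun s => k s * s `^ (- a))}.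
    by apply: cvgM; [exact: ck1|exact: powR_continuous_gt0].
  rewrite /continuous_at fE ?t0//; apply: cvg_trans ckt.
  apply: near_eq_cvg; near=> s; rewrite fE//; apply/andP; split; near: s.
    exact: lt_nbhsr.
  exact: lt_nbhsl.
have mf0 : measurable_fun `]0, y] f.
  have m01 : measurable_fun (`]0, 1[%classic : set R) f.
    by apply: open_continuous_measurable_fun => // t; rewrite inE; exact: cf.
  apply: measurable_funS m01; first exact: measurable_itv.
  by apply: subset_itvl; rewrite bnd_simp.
(* Nothing is known of [f] at 0, which for the phase is a two-sided derivative at the end of the
   domain; the point is adjoined as a measurable singleton and dropped again as a null set. *)
have mf : measurable_fun `[0, y] f.
  rewrite -(@setU1itv _ _ (BRight y) 0 false) ?bnd_simp ?ltW//.
  by apply/measurable_funU => //; split => //; exact: measurable_fun_set1.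
have intf : mu.-integrable `[0, y] (EFin \o f).
  apply/integrableP; split; first exact/measurable_EFinP.
  have cnk : {within `[0, y], continuous (fun t => `|k t|)}.
    have cky : {within `[0, y], continuous k}.
      by apply: continuous_subspaceW ck; apply: subset_itvl; rewrite bnd_simp.
    move/subspace_continuousP : cky => cky; apply/subspace_continuousP => t ty.
    by apply: cvg_norm; exact: cky.
  have [c _ kc] := EVT_max (ltW y0) cnk.
  rewrite -integral_itv_obnd_cbnd; last first.
    by apply/measurable_EFinP; exact: measurableT_comp.
  apply: (@le_lt_trans _ _
      (\int[mu]_(t in `]0%R, y]) (`|k c|%:E * (t `^ (- a))%:E))%E).
    apply: ge0_le_integral => //=.
    - by apply/measurable_EFinP; exact: measurableT_comp.
    - apply/measurable_EFinP; apply: measurable_funM => //.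
      by apply: (measurable_funS measurableT) => //; exact: measurable_powR.
    - move=> t; rewrite in_itv/= => /andP[t0 ty].
      rewrite fE ?t0 ?(le_lt_trans ty)// normrM (ger0_norm (powR_ge0 _ _)).
      by rewrite lee_fin ler_wpM2r ?powR_ge0// kc// in_itv/= ty ltW.
  rewrite ge0_integralZl//; last 2 first.
  - apply/measurable_EFinP.
    by apply: (measurable_funS measurableT) => //; exact: measurable_powR.
  - by move=> t _; rewrite lee_fin powR_ge0.
  by rewrite lte_mul_pinfty// ?lee_fin// integral_powR_near0_lty.
split.
- by rewrite /F set_itv1 Rintegral_set1.
- exact: parameterized_integral_continuous (ltW y0) intf.
- move=> t /andP[t0 ty].
  have t01 : t \in `]0, 1[ by rewrite in_itv/= t0 (lt_trans ty).
  have [d1 d2] := continuous_FTC1_closed ty intf t0 (cf _ t01).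
  by apply: DeriveDef => //; rewrite -derive1E.
Unshelve. all: by end_near. Qed.

End Phase.

(** * Complex-valued functions *)

Section ComplexLimits.
Context {R : realType}.

Lemma normcE (z : R[i]) : `|z| = (Normc.normc z)%:C. Proof. by []. Qed.

Lemma ReB (z w : R[i]) : complex.Re (z - w) = complex.Re z - complex.Re w.
Proof. by case: z w => [? ?] []. Qed.

Lemma ImB (z w : R[i]) : complex.Im (z - w) = complex.Im z - complex.Im w.
Proof. by case: z w => [? ?] []. Qed.

Lemma normc_le_ReIm (z : R[i]) :
  Normc.normc z <= `|complex.Re z| + `|complex.Im z|.
Proof.
case: z => u v /=.
rewrite -[leRHS]ger0_norm ?addr_ge0// -sqrtr_sqr ler_wsqrtr//.
rewrite sqrrD !real_normK ?num_real// addrAC lerDl.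
by rewrite mulrn_wge0// mulr_ge0.
Qed.

Lemma Re_le_normc (z : R[i]) : `|complex.Re z| <= Normc.normc z.
Proof. by case: z => u v /=; rewrite -sqrtr_sqr ler_wsqrtr// lerDl sqr_ge0. Qed.

Lemma Im_le_normc (z : R[i]) : `|complex.Im z| <= Normc.normc z.
Proof. by case: z => u v /=; rewrite -sqrtr_sqr ler_wsqrtr// lerDr sqr_ge0. Qed.

(** A positive element of [R[i]] has zero imaginary part, so the complex radii of its topology are
    exactly the positive real ones. *)
Lemma cvg_normcP (T : Type) (F : set_system T) (FF : Filter F)
    (f : T -> R[i]) (l : R[i]) :
  f @ F --> l <->
  (forall e : R, 0 < e -> \forall t \near F, Normc.normc (l - f t) <= e).
Proof.
split.
  move/cvgrPdist_le => fl e e0; have := fl e%:C.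
  rewrite ltcR => /(_ e0); apply: filterS => t.
  by rewrite normcE lecR.
move=> fl; apply/cvgrPdist_le => -[e i]; rewrite ltcE/= => /andP[/eqP -> e0].
have {}fl := fl _ e0; near=> t; rewrite normcE lecR; near: t; exact: fl.
Unshelve. all: by end_near. Qed.

Lemma cvg_complexP (T : Type) (F : set_system T) (FF : Filter F)
    (f : T -> R[i]) (l : R[i]) :
  f @ F --> l <->
  (complex.Re (f t) @[t --> F] --> complex.Re l) /\
  (complex.Im (f t) @[t --> F] --> complex.Im l).
Proof.
split.
  move/cvg_normcP => fl.
  split; apply/cvgrPdist_le => e /fl; apply: filterS => t; apply: le_trans.
    by rewrite -ReB Re_le_normc.
  by rewrite -ImB Im_le_normc.
move=> [/cvgrPdist_le fr /cvgrPdist_le fi]; apply/cvg_normcP => e e0.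
have e2 : 0 < e / 2 by rewrite divr_gt0.
near=> t; rewrite (le_trans (normc_le_ReIm _))// [leRHS]splitr lerD//.
  by rewrite ReB; near: t; exact: fr.
by rewrite ImB; near: t; exact: fi.
Unshelve. all: by end_near. Qed.

Lemma within_Re_continuous (T : topologicalType) (A : set T) (f : T -> R[i]) :
  {within A, continuous f} -> {within A, continuous (fun t => complex.Re (f t))}.
Proof.
move/subspace_continuousP => cf; apply/subspace_continuousP => t At.
by have /cvg_complexP[] := cf t At.
Qed.

Lemma within_Im_continuous (T : topologicalType) (A : set T) (f : T -> R[i]) :
  {within A, continuous f} -> {within A, continuous (fun t => complex.Im (f t))}.
Proof.
move/subspace_continuousP => cf; apply/subspace_continuousP => t At.
by have /cvg_complexP[] := cf t At.
Qed.

Lemma cvg_normc (T : Type) (F : set_system T) (FF : Filter F)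
    (f : T -> R[i]) (l : R[i]) :
  f @ F --> l -> Normc.normc (f t) @[t --> F] --> Normc.normc l.
Proof.
move/cvg_normcP => fl; apply/cvgrPdist_le => e /fl; apply: filterS => t.
apply: le_trans.
have := ler_dist_dist l (f t); rewrite !normcE -rmorphB lecR.
by rewrite /= expr0n addr0 sqrtr_sqr.
Qed.

Lemma normc_expi (s : R) : Normc.normc (expi s) = 1.
Proof. by rewrite /= cos2Dsin2 sqrtr1. Qed.

Lemma normc_real (s : R) : 0 <= s -> Normc.normc s%:C = s.
Proof. by move=> s0; rewrite /= expr0n addr0 sqrtr_sqr ger0_norm. Qed.

End ComplexLimits.

(** * The edge limit in real coordinates *)

Section CoreTools.
Context {R : realType}.

Lemma is_derive1_inv (f : R -> R) (t df : R) : f t != 0 ->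
  is_derive t 1 f df -> is_derive t 1 (fun s => (f s)^-1) (- df / f t ^+ 2).
Proof.
move=> f0 fd; apply: (is_derive_eq (is_deriveV f0 fd)).
by rewrite /GRing.scale/= -exprVn; ring.
Qed.

Lemma is_derive1_sqrt_sub (c t : R) : t < c ->
  is_derive t 1 (fun s => Num.sqrt (c - s)) (- (2 * Num.sqrt (c - t))^-1).
Proof.
move=> tc; have d : is_derive t 1 (fun s => c - s) (0 - 1).
  exact: is_derive1_sub.
have ds : is_derive (c - t) 1 Num.sqrt (2 * Num.sqrt (c - t))^-1.
  have ct0 : 0 < c - t by rewrite subr_gt0.
  exact: is_derive1_sqrt.
apply: (is_derive_eq (@is_derive1_comp R Num.sqrt (fun s => c - s) t _ _ ds d)).
by ring.
Qed.

Lemma continuous_within_segment_derive (v dv : R -> R) (y : R) : 0 < y ->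
  (forall t, 0 < t <= y -> is_derive t 1 v (dv t)) ->
  v t @[t --> 0^'+] --> v 0 -> {within `[0, y], continuous v}.
Proof.
move=> y0 vd v0.
have cv t : 0 < t <= y -> {for t, continuous v}.
  move=> ty; apply: differentiable_continuous; apply/derivable1_diffP.
  have dt := vd _ ty; exact: ex_derive.
apply/continuous_within_itvP => //; split => //.
- by move=> t; rewrite in_itv/= => /andP[t0 /ltW ty]; apply: cv; rewrite t0.
- by apply: cvg_at_left_filter; apply: cv; rewrite y0 lexx.
Qed.

Lemma within_D_powR_fst_continuous (b : R) : 0 < b ->
  {within D, continuous (fun p : R * R => p.1 `^ b)}.
Proof.
move=> b0; apply/subspace_continuousP => -[x t] [/= x0 t0 xt].
have x01 : `[0, 1]%classic x by rewrite /= in_itv/= x0/=; lra.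
have /within_cvg/(_ x01) := powR_continuous_ge0 b0 (@ler01 R).
apply: cvg_comp.
move=> A /= -[e /= e0 eA]; exists (ball x e, setT) => /=.
  by split; [exact: nbhsx_ballx|exact: filterT].
move=> [x' t'] /= [xx' _] [/= x'0 t'0 xt']; apply: eA => //.
by rewrite in_itv/= x'0/=; lra.
Qed.

Lemma within_D_sqrt_continuous :
  {within D, continuous (fun p : R * R => Num.sqrt (1 - p.1 - p.2))}.
Proof.
apply: continuous_subspaceT => p.
apply: (@cvg_comp _ _ _ (fun p : R * R => 1 - p.1 - p.2) Num.sqrt);
  last exact: sqrt_continuous.
by apply: cvgB; [apply: cvgB; [exact: cvg_cst|exact: cvg_fst]|exact: cvg_snd].
Qed.

Lemma D_edge_cvg (H : R * R -> R) (y : R) : {within D, continuous H} ->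
  0 <= y < 1 -> H (x, y) @[x --> 0^'+] --> H (0, y).
Proof.
move=> cH /andP[y0 y1]; apply/cvgrPdist_le => e e0.
have := D_edge_uniform cH y1 e0; apply: filterS => x /(_ y).
by rewrite distrC; apply; rewrite y0 lexx.
Qed.

End CoreTools.

Section CoreEstimate.
Context {R : realType}.

(** The factor sqrt(c - s)/f(s) has logarithmic derivative -1/(2(c - s)) - f'/f and so removes every
    term proportional to u. What remains is the source p and the term r, which couples the real and
    imaginary parts of E_x and becomes the rotation. In the application c = 1 - x and k =
    x^alpha. *)
Lemma is_derive_weighted (k c t p r : R) (f u : R -> R) (f' : R) :
  t < c -> f t != 0 -> is_derive t 1 f f' ->
  is_derive t 1 u ((u t + p) / (2 * (c - t)) + (u t * f' + r) / f t) ->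
  is_derive t 1 (fun s => k * u s * (Num.sqrt (c - s) / f s))
    (k * p / (2 * Num.sqrt (c - t) * f t) +
     k * r * Num.sqrt (c - t) / f t ^+ 2).
Proof.
move=> tc f0 df du.
have dw := is_derive1_mul (is_derive1_sqrt_sub tc) (is_derive1_inv f0 df).
apply: (is_derive_eq (is_derive1_mul (is_derive1_scale k du) dw)).
have S0 : Num.sqrt (c - t) != 0 by rewrite gt_eqF// sqrtr_gt0 subr_gt0.
have E : c - t = Num.sqrt (c - t) ^+ 2 by rewrite sqr_sqrtr// subr_ge0 ltW.
move: S0 E; set S := Num.sqrt (c - t) => S0 ->.
by field; rewrite f0.
Qed.

Lemma expR_sub1_cvg0 (C : R) (e : R) : 0 < e ->
  exists2 d : R, 0 < d & expR (C * d) - 1 <= e.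
Proof.
move=> e0.
have /cvgrPdist_le/(_ _ e0) : expR (C * d) @[d --> 0^'+] --> (1 : R).
  have -> : (1 : R) = expR (C * 0) by rewrite mulr0 expR0.
  apply: (@cvg_comp _ _ _ (fun d => C * d) expR _ _ _ _ (@continuous_expR R _)).
  apply: cvgMl_tmp; exact: cvg_within.
move=> H; have : \forall d \near (0 : R)^'+, 0 < d /\ expR (C * d) - 1 <= e.
  near=> d; split; first by near: d; exact: nbhs_right_gt.
  by rewrite (le_trans (ler_norm _))// distrC; near: d; exact: H.
by move=> /filter_ex[d [d0 dP]]; exists d.
Unshelve. all: by end_near. Qed.

(* [f], [fx], [gx], [fy], [gy] stand for Re E, Re E_x, Im E_x, Re E_y, Im E_y;
   [F] and [G] extend y^a Re E_y and y^a Im E_y. *)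
Lemma ernst_edge_limit_real (alpha a y : R)
    (f fx gx fy gy F G : R * R -> R) (th dth : R -> R) (m1 m2 : R) :
  0 < alpha -> a < 1 -> 0 < y < 1 ->
  {within D, continuous f} -> (forall p, D p -> 0 < f p) ->
  {within D, continuous F} -> {within D, continuous G} -> f (0, 0) = 1 ->
  (forall x t : R, 0 < x -> 0 < t -> x + t < 1 ->
    [/\ is_derive t 1 (fun s => f (x, s)) (fy (x, t)),
        is_derive t 1 (fun s => fx (x, s))
         ((fx (x, t) + fy (x, t)) / (2 * (1 - x - t)) +
          (fx (x, t) * fy (x, t) - gx (x, t) * gy (x, t)) / f (x, t)),
        is_derive t 1 (fun s => gx (x, s))
         ((gx (x, t) + gy (x, t)) / (2 * (1 - x - t)) +
          (gx (x, t) * fy (x, t) + fx (x, t) * gy (x, t)) / f (x, t)),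
        F (x, t) = t `^ a * fy (x, t) &
        G (x, t) = t `^ a * gy (x, t)]) ->
  (forall x : R, 0 < x < 1 -> fx (x, t) @[t --> 0^'+] --> fx (x, 0)) ->
  (forall x : R, 0 < x < 1 -> gx (x, t) @[t --> 0^'+] --> gx (x, 0)) ->
  x `^ alpha * fx (x, 0) @[x --> 0^'+] --> m1 ->
  x `^ alpha * gx (x, 0) @[x --> 0^'+] --> m2 ->
  th 0 = 0 -> {within `[0, y], continuous th} ->
  (forall t, 0 < t < y -> is_derive t 1 th (dth t)) ->
  (forall t, 0 < t < y -> G (0, t) / f (0, t) = t `^ a * dth t) ->
  (x `^ alpha * fx (x, y) @[x --> 0^'+] -->
    (m1 * cos (th y) - m2 * sin (th y)) * (f (0, y) / Num.sqrt (1 - y))) /\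
  (x `^ alpha * gx (x, y) @[x --> 0^'+] -->
    (m1 * sin (th y) + m2 * cos (th y)) * (f (0, y) / Num.sqrt (1 - y))).
Proof.
move=> al0 a1 /andP[y0 y1] cf f0 cF cG f00 eqs fx0 gx0 fxm gxm th0 cth dth_ Gth.
pose S (p : R * R) := Num.sqrt (1 - p.1 - p.2).
have S_gt0 x t : x + t < 1 -> 0 < S (x, t) by move=> xt; rewrite sqrtr_gt0/=; lra.
pose w x s := S (x, s) / f (x, s).
pose V1 x s := x `^ alpha * fx (x, s) * w x s.
pose V2 x s := x `^ alpha * gx (x, s) * w x s.
pose Z1 x := V1 x 0 * cos (th y) - V2 x 0 * sin (th y).
pose Z2 x := V1 x 0 * sin (th y) + V2 x 0 * cos (th y).
have y01 : 0 <= y < 1 by rewrite ltW.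
have cw t : 0 <= t < 1 -> w x t @[x --> 0^'+] --> S (0, t) / f (0, t).
  move=> t01; have /andP[t0 t1] := t01; apply: cvgM.
    by apply: (D_edge_cvg (H := S)) => //; exact: within_D_sqrt_continuous.
  apply: cvgV; last exact: D_edge_cvg.
  by rewrite gt_eqF// f0//; split => //=; rewrite add0r.
have w0 : w x 0 @[x --> 0^'+] --> (1 : R).
  have := cw 0; rewrite f00 /S/= !subr0 sqrtr1 divr1.
  by apply; rewrite lexx ltr01.
have V1m : V1 x 0 @[x --> 0^'+] --> m1.
  by rewrite -[m1]mulr1; exact: cvgM.
have V2m : V2 x 0 @[x --> 0^'+] --> m2.
  by rewrite -[m2]mulr1; exact: cvgM.
(* The summand 1 makes the bounds strict, so that they hold for V1(x, 0) and V2(x, 0) as soon as x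
   is small. *)
pose M := `|m1| + `|m2| + 1.
have M0 : 0 <= M by rewrite /M !addr_ge0.
pose Phi (p : R * R) := G p / f p.
have cinv : {within D, continuous (fun p => (f p)^-1)}.
  apply/subspace_continuousP => p Dp; apply: cvgV; first by rewrite gt_eqF// f0.
  exact: within_cvg.
have cPhi : {within D, continuous Phi}.
  apply/subspace_continuousP => p Dp.
  by apply: cvgM; [exact: within_cvg cG Dp|exact: within_cvg cinv Dp].
(* For H = [F] or [G] this is t^a times the source term [F1] or [F2] below. It vanishes on the edge
   x = 0 because alpha > 0, so uniform convergence to the edge makes it small for all t in [0, y] at
   once. *)
pose Psi (H : R * R -> R) (p : R * R) := p.1 `^ alpha * H p * ((2 * S p)^-1 * (f p)^-1).
have cPsi H : {within D, continuous H} -> {within D, continuous (Psi H)}.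
  move=> cH; apply/subspace_continuousP => p Dp; apply: cvgM.
    apply: cvgM; last exact: within_cvg cH Dp.
    exact: within_cvg (within_D_powR_fst_continuous al0) Dp.
  apply: cvgM; last exact: within_cvg cinv Dp.
  have Sp : 0 < S p by case: p Dp => x t [/= _ _]; exact: S_gt0.
  apply: cvgV; first by rewrite gt_eqF// mulr_gt0.
  by apply: cvgMl_tmp; exact: (within_cvg within_D_sqrt_continuous Dp).
have close e : 0 < e -> \forall x \near (0 : R)^'+,
    (V1 x y - Z1 x) ^+ 2 + (V2 x y - Z2 x) ^+ 2 <= e.
  move=> e0.
  (* The constant is the one in the exponent of [rotation_perturbation]; [d] depends on neither x
     nor t. *)
  have [d d0 de] := expR_sub1_cvg0 (2 * (2 * M + 1) * (y `^ (1 - a) / (1 - a))) e0.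
  have nPhi := D_edge_uniform cPhi y1 d0.
  have nF := D_edge_uniform (cPsi _ cF) y1 d0.
  have nG := D_edge_uniform (cPsi _ cG) y1 d0.
  have M1 : `|m1| < M by rewrite /M -addrA ltrDl; apply: ltr_wpDl.
  have M2 : `|m2| < M by rewrite /M addrAC ltrDr; apply: ltr_wpDl.
  have nV1 : \forall x \near (0 : R)^'+, `|V1 x 0| < M := cvgr_lt _ (cvg_norm V1m) _ M1.
  have nV2 : \forall x \near (0 : R)^'+, `|V2 x 0| < M := cvgr_lt _ (cvg_norm V2m) _ M2.
  near=> x.
  have x0 : 0 < x by near: x; exact: nbhs_right_gt.
  have xy : x + y < 1.
    by rewrite -ltrBrDr; near: x; apply: nbhs_right_lt; rewrite subr_gt0.
  have x1 : 0 < x < 1 by rewrite x0/=; lra.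
  have fne t : 0 <= t <= y -> f (x, t) != 0.
    by move=> /andP[t0 ty]; rewrite gt_eqF// f0//; split => //=; lra.
  pose ph t := gy (x, t) / f (x, t).
  pose F1 t := x `^ alpha * fy (x, t) / (2 * S (x, t) * f (x, t)).
  pose F2 t := x `^ alpha * gy (x, t) / (2 * S (x, t) * f (x, t)).
  have dV1 t : 0 < t <= y -> is_derive t 1 (V1 x) (F1 t - ph t * V2 x t).
    move=> /andP[t0 ty]; have xt : x + t < 1 by lra.
    have [df dfx _ _ _] := eqs x t x0 t0 xt.
    have ft0 : f (x, t) != 0 by rewrite fne// ty ltW.
    have tc : t < 1 - x by lra.
    apply: (is_derive_eq (is_derive_weighted (x `^ alpha) tc ft0 df dfx)).
    by rewrite /F1 /ph /V2 /w /S/=; field; rewrite ft0 gt_eqF// S_gt0.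
  have dV2 t : 0 < t <= y -> is_derive t 1 (V2 x) (F2 t + ph t * V1 x t).
    move=> /andP[t0 ty]; have xt : x + t < 1 by lra.
    have [df _ dgx _ _] := eqs x t x0 t0 xt.
    have ft0 : f (x, t) != 0 by rewrite fne// ty ltW.
    have tc : t < 1 - x by lra.
    apply: (is_derive_eq (is_derive_weighted (x `^ alpha) tc ft0 df dgx)).
    by rewrite /F2 /ph /V1 /w /S/=; field; rewrite ft0 gt_eqF// S_gt0.
  have w_cvg : w x t @[t --> 0^'+] --> w x 0.
    have x01 : 0 <= x < 1 by case/andP: x1 => /ltW ->.
    apply: cvgM.
      by apply: (within_D_vertical_cvg (H := S)) => //; exact: within_D_sqrt_continuous.
    by apply: (within_D_vertical_cvg (H := fun p => (f p)^-1)).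
  have cV1 : {within `[0, y], continuous (V1 x)}.
    apply: (continuous_within_segment_derive y0 dV1).
    by apply: cvgM => //; apply: cvgMl_tmp; exact: fx0.
  have cV2 : {within `[0, y], continuous (V2 x)}.
    apply: (continuous_within_segment_derive y0 dV2).
    by apply: cvgM => //; apply: cvgMl_tmp; exact: gx0.
  have scale t (u v : R) : 0 < t -> `|u| <= d -> u = t `^ a * v -> `|v| <= d * t `^ (- a).
    move=> t0 ud uE; rewrite powRN ler_pdivlMr ?powR_gt0//.
    by move: ud; rewrite uE normrM (ger0_norm (powR_ge0 _ _)) mulrC.
  have weak t : 0 < t < y -> 0 < t <= y by case/andP => -> /ltW.
  apply: le_trans de.
  have := @rotation_perturbation R a d M y (V1 x) (V2 x) th dth ph F1 F2
    a1 y0 M0 cV1 cV2 cth th0 (fun t ty => dV1 t (weak t ty))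
    (fun t ty => dV2 t (weak t ty)) dth_.
  rewrite (_ : 2 * (2 * M + 1) * d * (y `^ (1 - a) / (1 - a)) =
    2 * (2 * M + 1) * (y `^ (1 - a) / (1 - a)) * d); last by ring.
  have Psi0 H t : Psi H (0, t) = 0.
    by rewrite /Psi/= powR0 ?mul0r// gt_eqF.
  apply.
  - move=> t /[dup] ty /andP[t0 t1].
    have [_ _ _ _ GE] := eqs x t x0 t0 ltac:(lra).
    apply: (scale t (Phi (x, t) - Phi (0, t))) => //.
      have : forall t, 0 <= t <= y -> `|Phi (x, t) - Phi (0, t)| <= d by near: x.
      by apply; rewrite !ltW.
    by rewrite /Phi Gth// GE /ph; ring.
  - move=> t /[dup] ty /andP[t0 t1].
    have [_ _ _ FE _] := eqs x t x0 t0 ltac:(lra).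
    apply: (scale t (Psi F (x, t) - Psi F (0, t))) => //.
      have : forall t, 0 <= t <= y -> `|Psi F (x, t) - Psi F (0, t)| <= d by near: x.
      by apply; rewrite !ltW.
    by rewrite Psi0 subr0 /Psi FE /F1 !invfM/=; ring.
  - move=> t /[dup] ty /andP[t0 t1].
    have [_ _ _ _ GE] := eqs x t x0 t0 ltac:(lra).
    apply: (scale t (Psi G (x, t) - Psi G (0, t))) => //.
      have : forall t, 0 <= t <= y -> `|Psi G (x, t) - Psi G (0, t)| <= d by near: x.
      by apply; rewrite !ltW.
    by rewrite Psi0 subr0 /Psi GE /F2 !invfM/=; ring.
  - by apply: ltW; near: x; exact: nV1.
  - by apply: ltW; near: x; exact: nV2.
have Z1m : Z1 x @[x --> 0^'+] --> m1 * cos (th y) - m2 * sin (th y).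
  by apply: cvgB; apply: cvgMr_tmp.
have Z2m : Z2 x @[x --> 0^'+] --> m1 * sin (th y) + m2 * cos (th y).
  by apply: cvgD; apply: cvgMr_tmp.
have sq_le (u v e : R) : 0 < e -> u ^+ 2 + v ^+ 2 <= e ^+ 2 -> `|u| <= e /\ `|v| <= e.
  move=> e0 uv; split; rewrite -[leRHS]ger0_norm ?(ltW e0)// -ler_sqr ?nnegrE//.
    by rewrite !real_normK ?num_real// (le_trans _ uv)// lerDl sqr_ge0.
  by rewrite !real_normK ?num_real// (le_trans _ uv)// lerDr sqr_ge0.
have VZ1 : V1 x y - Z1 x @[x --> 0^'+] --> (0 : R).
  apply/cvgrPdist_le => e e0; have := close (e ^+ 2) (exprn_gt0 2 e0).
  by apply: filterS => x /(sq_le _ _ _ e0)[]; rewrite sub0r normrN.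
have VZ2 : V2 x y - Z2 x @[x --> 0^'+] --> (0 : R).
  apply/cvgrPdist_le => e e0; have := close (e ^+ 2) (exprn_gt0 2 e0).
  by apply: filterS => x /(sq_le _ _ _ e0)[]; rewrite sub0r normrN.
have winv : (w x y)^-1 @[x --> 0^'+] --> f (0, y) / Num.sqrt (1 - y).
  have -> : f (0, y) / Num.sqrt (1 - y) = (S (0, y) / f (0, y))^-1.
    by rewrite invf_div /S/= subr0.
  apply: cvgV; last exact: cw.
  have Sy : 0 < S (0, y) by apply: S_gt0; rewrite add0r.
  have fy0 : 0 < f (0, y) by apply: f0; split => //=; rewrite ?ltW ?add0r.
  by rewrite mulf_neq0// ?invr_eq0 gt_eqF.
have wne : \forall x \near (0 : R)^'+, w x y != 0.
  near=> x.
  have x0 : 0 < x by near: x; exact: nbhs_right_gt.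
  have xy : x + y < 1.
    by rewrite -ltrBrDr; near: x; apply: nbhs_right_lt; rewrite subr_gt0.
  have fy0 : 0 < f (x, y) by apply: f0; split => //=; rewrite ltW.
  by rewrite mulf_neq0// ?invr_eq0 gt_eqF// S_gt0.
(* The weight is undone: it tends to sqrt(1 - y)/f(0, y), and the inverse of this limit is the
   amplitude in the conclusion. *)
have final (u : R -> R) (Z : R -> R) (m : R) :
    u x * w x y - Z x @[x --> 0^'+] --> (0 : R) -> Z x @[x --> 0^'+] --> m ->
    u x @[x --> 0^'+] --> m * (f (0, y) / Num.sqrt (1 - y)).
  move=> uZ Zm.
  have uw : u x * w x y @[x --> 0^'+] --> m.
    have : u x * w x y - Z x + Z x @[x --> 0^'+] --> 0 + m by exact: cvgD.
    rewrite add0r; apply: cvg_trans.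
    by apply: near_eq_cvg; near=> x; rewrite subrK.
  have : u x * w x y * (w x y)^-1 @[x --> 0^'+] -->
    m * (f (0, y) / Num.sqrt (1 - y)) by exact: cvgM.
  apply: cvg_trans.
  apply: near_eq_cvg; near=> x; have wx : w x y != 0 by near: x; exact: wne.
  by rewrite mulfK.
split.
  exact: (final (fun x => x `^ alpha * fx (x, y)) _ _ VZ1 Z1m).
exact: (final (fun x => x `^ alpha * gx (x, y)) _ _ VZ2 Z2m).
Unshelve. all: by end_near. Qed.

End CoreEstimate.

(** * The edge limit *)

Section ComplexDerivative.
Context {R : realType}.

Lemma is_derive_Re (f : R -> R[i]) (x : R) : cderivable f x ->
  is_derive x 1 (fun t => complex.Re (f t)) (complex.Re (cderive f x)).
Proof. by move=> [fr _]; apply: DeriveDef => //=; rewrite derive1E. Qed.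

Lemma is_derive_Im (f : R -> R[i]) (x : R) : cderivable f x ->
  is_derive x 1 (fun t => complex.Im (f t)) (complex.Im (cderive f x)).
Proof. by move=> [_ fi]; apply: DeriveDef => //=; rewrite derive1E. Qed.

Lemma cderive_val (f : R -> R[i]) (x u v : R) :
  is_derive x 1 (fun t => complex.Re (f t)) u ->
  is_derive x 1 (fun t => complex.Im (f t)) v -> cderive f x = u +i* v.
Proof. by move=> fu fv; rewrite /cderive !derive1E !derive_val. Qed.

Lemma near_eq_cderive (f g : R -> R[i]) (x : R) :
  (\forall t \near x, f t = g t) -> cderive f x = cderive g x.
Proof.
move=> fg; rewrite /cderive !derive1E; congr (_ +i* _);
  by apply: near_eq_derive; rewrite ?oner_eq0//; apply: filterS fg => t ->.
Qed.

Lemma ReMreal (z : R[i]) (s : R) : complex.Re (z * s%:C) = complex.Re z * s.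
Proof. by case: z => u v /=; rewrite mulr0 subr0. Qed.

Lemma ImMreal (z : R[i]) (s : R) : complex.Im (z * s%:C) = complex.Im z * s.
Proof. by case: z => u v /=; rewrite mulr0 add0r. Qed.

Lemma Re_realM (z : R[i]) (s : R) : complex.Re (s%:C * z) = s * complex.Re z.
Proof. by rewrite mulrC ReMreal mulrC. Qed.

Lemma Im_realM (z : R[i]) (s : R) : complex.Im (s%:C * z) = s * complex.Im z.
Proof. by rewrite mulrC ImMreal mulrC. Qed.

(** The interior of [D] by explicit inequalities, which makes its invariance under the exchange of
    coordinates immediate. *)
Definition posD : set (R * R) :=
  [set p | [/\ 0 < p.1, 0 < p.2 & p.1 + p.2 < 1]].

Lemma posD_sub : posD `<=` D.
Proof. by move=> p [? ? ?]; split => //; exact: ltW. Qed.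

Lemma posD_interior : posD `<=` D^°.
Proof.
move=> p [p1 p2 p12].
have cs : (fun q : R * R => q.1 + q.2) @ p --> p.1 + p.2.
  by apply: cvgD; [exact: cvg_fst|exact: cvg_snd].
near=> q; apply: posD_sub; split; near: q.
- exact: (cvgr_gt _ (@cvg_fst _ _ _ _ _)).
- exact: (cvgr_gt _ (@cvg_snd _ _ _ _ _)).
- exact: (cvgr_lt _ cs).
Unshelve. all: by end_near. Qed.

(* The part of the definition of a solution that the proof uses.  By Schwarz's
   theorem it is invariant under the exchange of x and y. *)
Record regular_ernst (a : R) (E : R * R -> R[i]) : Prop := RegularErnst {
  regular_cont : {within D, continuous E} ;
  regular_Re_gt0 : forall p, D p -> 0 < complex.Re (E p) ;
  regular_dx : forall p, posD p -> cderivable (fun s => E (s, p.2)) p.1 ;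
  regular_dy : forall p, posD p -> cderivable (fun t => E (p.1, t)) p.2 ;
  regular_dxy : forall p, posD p -> cderivable (fun t => dx E (p.1, t)) p.2 ;
  regular_eq : forall p, posD p -> ernst_eq E p ;
  regular_extx : cont_ext posD D (fun p => (p.1 `^ a)%:C * dx E p) ;
  regular_exty : cont_ext posD D (fun p => (p.2 `^ a)%:C * dy E p)
}.

Definition swap (p : R * R) : R * R := (p.2, p.1).

Lemma within_D_swap_continuous (T : topologicalType) (f : R * R -> T) :
  {within D, continuous f} -> {within D, continuous (f \o swap)}.
Proof.
move=> cf; apply/subspace_continuousP => p [p1 p2 p12].
have Dsp : D (swap p) by split => //=; rewrite addrC.
apply: (@cvg_comp _ _ _ swap f _ _ _ _ (within_cvg cf Dsp)).
case: p p1 p2 p12 Dsp => x t x0 t0 xt _ A /= -[[/= B C] [/= Bt Cx] BC].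
exists (C, B) => //= -[x' t'] /= [Cx' Bt'] [/= x'0 t'0 xt'].
by apply: (BC (t', x')) => //; split => //=; rewrite addrC.
Qed.

Lemma Cn2S (n : nat) (U : set (R * R)) (F : R * R -> R[i]) : Cn2 n.+1 U F ->
  [/\ {within U, continuous F},
      forall p, U p -> cderivable (fun t => F (t, p.2)) p.1,
      forall p, U p -> cderivable (fun t => F (p.1, t)) p.2,
      Cn2 n U (dx F) & Cn2 n U (dy F)].
Proof.
by move=> [cF [dF Fx Fy]]; split => // p /dF[].
Qed.

Lemma Cn2_cont (n : nat) (U : set (R * R)) (F : R * R -> R[i]) :
  Cn2 n U F -> {within U, continuous F}.
Proof. by case: n => [|n] []. Qed.

(** Order two already makes both mixed derivatives continuous on the open set [D^°], where
    continuity within the set is continuity. The real theorem is applied to each component, [pr]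
    being Re or Im. *)
Lemma regular_schwarz (n : nat) (E : R * R -> R[i]) : (2 <= n)%N ->
  Cn2 n D^° E -> forall p, posD p -> dx (dy E) p = dy (dx E) p.
Proof.
move=> n2; rewrite -(subnKC n2) => /Cn2S[_ dE dE'] /Cn2S[_ _ dxE _ /Cn2_cont cxy].
move=> /Cn2S[_ dyE _ /Cn2_cont cyx _].
move=> p /posD_interior pD.
have nD : \forall q \near p, D^° q.
  by apply: open_nbhs_nbhs; split; [exact: open_interior|].
have comp (pr : R[i] -> R) : (forall f : R -> R[i], forall x, cderivable f x ->
      is_derive x 1 (fun t => pr (f t)) (pr (cderive f x))) ->
    (forall A : set (R * R), forall f : R * R -> R[i], {within A, continuous f} ->
      {within A, continuous (fun q => pr (f q))}) ->
    pr (dy (dx E) p) = pr (dx (dy E) p).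
  move=> dpr cpr.
  apply: (@schwarz R (pr \o E) (pr \o dx E) (pr \o dy E)
    (pr \o dy (dx E)) (pr \o dx (dy E)) p).
  - by apply: filterS nD => q /dE/dpr.
  - by apply: filterS nD => q /dE'/dpr.
  - by apply: filterS nD => q /dxE/dpr.
  - by apply: filterS nD => q /dyE/dpr.
  - have := cpr _ _ cxy; rewrite continuous_open_subspace; last exact: open_interior.
    by move=> /(_ p); apply; rewrite inE.
  - have := cpr _ _ cyx; rewrite continuous_open_subspace; last exact: open_interior.
    by move=> /(_ p); apply; rewrite inE.
apply/eqP; rewrite eq_complex; apply/andP; split; apply/eqP/esym; apply: comp.
- exact: is_derive_Re.
- by move=> A f; exact: within_Re_continuous.
- exact: is_derive_Im.
- by move=> A f; exact: within_Im_continuous.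
Qed.

End ComplexDerivative.

Section EdgeLimit.
Context {R : realType}.

Lemma goursat_regular (n : nat) (E0 E1 : R -> R[i]) (E : R * R -> R[i]) :
  (2 <= n)%N -> is_goursat_solution n E0 E1 E ->
  exists a : R, [/\ 0 <= a < 1, regular_ernst a E & regular_ernst a (E \o swap)].
Proof.
move=> n2 [cE CE eqE [a [a01 extx exty _]] _ _ Re0].
have posext (f : R * R -> R[i]) : cont_ext D^° D f -> cont_ext posD D f
  by move=> [g [cg gf]]; exists g; split => // p /posD_interior; exact: gf.
have [dE dxE dyE] : [/\
    forall p, posD p -> cderivable (fun t => E (t, p.2)) p.1 /\
                        cderivable (fun t => E (p.1, t)) p.2,
    forall p, posD p -> cderivable (fun t => dx E (p.1, t)) p.2 &
    forall p, posD p -> cderivable (fun t => dy E (t, p.2)) p.1]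
  by move: CE; rewrite -(subnKC n2) => /Cn2S[_ dE dE'] /Cn2S[_ _ dxE _ _] /Cn2S[_ dyE _ _ _];
    split => p /posD_interior pD; [split; [exact: dE|exact: dE']|exact: dxE|exact: dyE].
exists a; split; first exact: a01.
- split.
  + exact: cE.
  + exact: Re0.
  + by move=> p /dE[].
  + by move=> p /dE[].
  + exact: dxE.
  + by move=> p /posD_interior; exact: eqE.
  + exact: posext.
  + exact: posext.
- have posS p : posD p -> posD (swap p) by move=> [? ? ?]; split => //=; rewrite addrC.
  have DS p : D p -> D (swap p) by move=> [? ? ?]; split => //=; rewrite addrC.
  have extS (f : R * R -> R[i]) : cont_ext posD D f -> cont_ext posD D (f \o swap).
    move=> [g [cg gf]]; exists (g \o swap).
    split; [exact: within_D_swap_continuous|by move=> p /posS; exact: gf].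
  split.
  + exact: within_D_swap_continuous.
  + by move=> p /DS; exact: Re0.
  + by move=> p /posS/dE[].
  + by move=> p /posS/dE[].
  + by move=> p /posS/dyE.
  + move=> p /posS pS; have := eqE _ (posD_interior pS).
    (* By conversion, derivatives of [E \o swap] at [p] are those of [E] at [swap p] with [dx] and
       [dy] exchanged. Only the mixed derivative then appears in the wrong order. *)
    change (ernst_eq E (swap p) ->
      (complex.Re (E (swap p)))%:C * (dx (dy E) (swap p) -
        (dy E (swap p) + dx E (swap p)) / (2 * (1 - p.1 - p.2))%:C) =
      dy E (swap p) * dx E (swap p)).
    rewrite (regular_schwarz n2 CE pS) (addrC (dy E _)) (mulrC (dy E _)).
    by rewrite (_ : 1 - p.1 - p.2 = 1 - (swap p).1 - (swap p).2)// /swap/=; ring.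
  + exact: (extS _ (posext _ exty)).
  + exact: (extS _ (posext _ extx)).
Qed.

(** With f = Re E, r = 2(1 - x - y), u = E_x, p = E_y and z = E_xy, this is the Ernst equation
    divided by Re E and split into components, in the form that [ernst_edge_limit_real] takes. *)
Lemma ernst_solve_xy (f r : R) (u p z : R[i]) : 0 < f -> 0 < r ->
  f%:C * (z - (u + p) / r%:C) = u * p ->
  complex.Re z = (complex.Re u + complex.Re p) / r +
    (complex.Re u * complex.Re p - complex.Im u * complex.Im p) / f /\
  complex.Im z = (complex.Im u + complex.Im p) / r +
    (complex.Im u * complex.Re p + complex.Re u * complex.Im p) / f.
Proof.
move=> f0 r0; rewrite -fmorphV/=; case: u p z => [u1 u2] [p1 p2] [z1 z2].
have fN0 : f != 0 by rewrite gt_eqF.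
have rN0 : r != 0 by rewrite gt_eqF.
move=> /eqP; rewrite eq_complex => /andP[/eqP/= h1 /eqP/= h2]; split.
  by rewrite -h1; field; rewrite fN0.
by rewrite (addrC (u2 * _)) -h2; field; rewrite fN0.
Qed.

Lemma within_D_axis_continuous (T : topologicalType) (f : R * R -> T) :
  {within D, continuous f} -> {within `[0, 1[, continuous (fun t => f (0, t))}.
Proof.
move=> cf; apply/subspace_continuousP => t /=; rewrite in_itv/= => /andP[t0 t1].
have Dt : D (0, t) by split => //=; rewrite add0r.
apply: (@cvg_comp _ _ _ (fun t => (0, t)) f _ _ _ _ (within_cvg cf Dt)).
move=> A /= -[[/= B C] [/= B0 Ct] BC].
apply: filterS Ct => s Cs; rewrite /= in_itv/= => /andP[s0 s1].
apply: (BC (0, s)) => /=; last by split => //=; rewrite add0r.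
by split => //; exact: nbhs_singleton.
Qed.

Lemma ernst_edge_limit (alpha a y : R) (E0 E1 : R -> R[i]) (E : R * R -> R[i])
    (m : R[i]) :
  0 < alpha -> a < 1 -> regular_ernst a E ->
  (forall x, 0 <= x < 1 -> E (x, 0) = E0 x) ->
  (forall y, 0 <= y < 1 -> E (0, y) = E1 y) -> E1 0 = 1 ->
  (x `^ alpha)%:C * cderive E0 x @[x --> 0^'+] --> m ->
  0 <= y < 1 ->
  (x `^ alpha)%:C * dx E (x, y) @[x --> 0^'+] -->
    m * (expi (phase E1 y) * (complex.Re (E1 y))%:C / (Num.sqrt (1 - y))%:C).
Proof.
move=> al0 a1 [cE Re0 dEx dEy dExy eqE [H [cH HE]] [K [cK KE]]] EE0 EE1 E10 E0m.
move=> /andP[y0 y1].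
(* For 0 < x < 1 a whole neighbourhood of x on the axis lies in the domain, so the two-sided
   derivative sees only boundary values. *)
have dxE0 x : 0 < x < 1 -> dx E (x, 0) = cderive E0 x.
  move=> /andP[x0 x1]; apply: near_eq_cderive; near=> t; apply: EE0.
  by apply/andP; split; [apply: ltW|]; near: t; [exact: lt_nbhsr|exact: lt_nbhsl].
have dyE1 t : 0 < t < 1 -> dy E (0, t) = cderive E1 t.
  move=> /andP[t0 t1]; apply: near_eq_cderive; near=> s; apply: EE1.
  by apply/andP; split; [apply: ltW|]; near: s; [exact: lt_nbhsr|exact: lt_nbhsl].
have near01 : \forall x \near (0 : R)^'+, 0 < x < 1.
  near=> x; apply/andP; split; near: x; first exact: nbhs_right_gt.
  by apply: nbhs_right_lt; exact: ltr01.
have {}E0m : (x `^ alpha)%:C * dx E (x, 0) @[x --> 0^'+] --> m.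
  apply: cvg_trans E0m; apply: near_eq_cvg.
  by apply: filterS near01 => x x01; rewrite dxE0.
(* At y = 0 phase and amplitude are trivial and the claim is the hypothesis on the datum. *)
move: y0; rewrite le_eqVlt => /predU1P[<-|y0].
  have -> : phase E1 0 = 0 by rewrite /phase set_itv1 Rintegral_set1.
  have -> : expi 0 = 1 :> R[i] by rewrite /expi cos0 sin0.
  by rewrite E10 subr0 sqrtr1 mul1r divr1 mulr1; exact: E0m.
have t01 t : 0 < t <= y -> 0 < t < 1 by move=> /andP[-> ty]; exact: le_lt_trans y1.
have cRe := within_Re_continuous cE.
have cIm := within_Im_continuous cE.
have cReH := within_Re_continuous cH.
have cImH := within_Im_continuous cH.
have cReK := within_Re_continuous cK.
have cImK := within_Im_continuous cK.
have pos (x t : R) : 0 < x -> 0 < t -> x + t < 1 -> posD (x, t) by [].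
(* A second expression for the derivative on the edge, through the extension [H]; it yields the
   convergence of E_x(x, t) as t -> 0, hence the initial value of V. *)
have edge_x x : 0 < x < 1 -> dx E (x, 0) =
    (complex.Re (H (x, 0)) / x `^ a) +i* (complex.Im (H (x, 0)) / x `^ a).
  move=> x01; apply: cderive_val => /=.
    apply: (edge_is_derive x01 cRe cReH (hx := fun p => complex.Re (dx E p))).
    move=> s t s0 t0 st; split; first exact: is_derive_Re (dEx _ (pos _ _ s0 t0 st)).
    by rewrite HE ?Re_realM//; exact: pos.
  apply: (edge_is_derive x01 cIm cImH (hx := fun p => complex.Im (dx E p))).
  move=> s t s0 t0 st; split; first exact: is_derive_Im (dEx _ (pos _ _ s0 t0 st)).
  by rewrite HE ?Im_realM//; exact: pos.
(* On the edge x = 0 this identifies the limit of t^a Im E_t / Re E with t^a times the integrand of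
   the phase. *)
have edge_y t : 0 < t < 1 -> complex.Im (dy E (0, t)) =
    complex.Im (K (0, t)) / t `^ a.
  move=> t01'.
  have d : is_derive t 1 (fun s => complex.Im (E (0, s))) (complex.Im (K (0, t)) / t `^ a).
    apply: (edge_is_derive t01' (within_D_swap_continuous cIm)
      (within_D_swap_continuous cImK) (hx := fun p => complex.Im (dy E (swap p)))).
    move=> s s' s0 s'0 ss; have ps : posD (s', s) by split; rewrite //= addrC.
    split; first exact: is_derive_Im (dEy _ ps).
    by rewrite /swap/= KE ?Im_realM.
  by rewrite /dy/cderive/= derive1E derive_val.
pose dth t := complex.Im (cderive E1 t) / complex.Re (E1 t).
have kE t : 0 < t < 1 ->
    complex.Im (K (0, t)) / complex.Re (E (0, t)) = t `^ a * dth t.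
  move=> t1; have /andP[t0 t1'] := t1.
  rewrite /dth -dyE1// edge_y// EE1; last by rewrite ltW.
  by rewrite mulrA [t `^ a * _]mulrC divfK// gt_eqF// powR_gt0.
have ck : {within `[0, 1[, continuous
    (fun t => complex.Im (K (0, t)) / complex.Re (E (0, t)))}.
  apply: (within_D_axis_continuous
    (f := fun p => complex.Im (K p) / complex.Re (E p))).
  apply/subspace_continuousP => p Dp; apply: cvgM; first exact: within_cvg cImK Dp.
  apply: cvgV; last exact: within_cvg cRe Dp.
  by rewrite gt_eqF// Re0.
have y01 : 0 < y < 1 by rewrite y0.
have [th0 cth dth_] := parameterized_integral_powR a1 y01 ck kE.
have vert (h hx : R * R -> R) : {within D, continuous h} ->
    (forall x t, posD (x, t) -> h (x, t) = x `^ a * hx (x, t)) ->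
    (forall x, 0 < x < 1 -> hx (x, 0) = h (x, 0) / x `^ a) ->
    forall x, 0 < x < 1 -> hx (x, t) @[t --> 0^'+] --> hx (x, 0).
  move=> ch hE h0 x x01; have /andP[x0 x1] := x01; rewrite h0//.
  have : h (x, t) / x `^ a @[t --> 0^'+] --> h (x, 0) / x `^ a.
    by apply: cvgMr_tmp; apply: within_D_vertical_cvg => //; rewrite ltW.
  apply: cvg_trans; apply: near_eq_cvg; near=> t.
  have t0 : 0 < t by near: t; exact: nbhs_right_gt.
  have xt : x + t < 1.
    by rewrite -ltrBrDl; near: t; apply: nbhs_right_lt; rewrite subr_gt0.
  by rewrite hE; [rewrite mulrC mulKf// gt_eqF// powR_gt0|exact: pos].
have fx0 := vert _ (fun p => complex.Re (dx E p)) cReH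
  (fun x t xt => etrans (congr1 _ (HE _ xt)) (Re_realM _ _))
  (fun x x01 => congr1 (@complex.Re R) (edge_x x x01)).
have gx0 := vert _ (fun p => complex.Im (dx E p)) cImH
  (fun x t xt => etrans (congr1 _ (HE _ xt)) (Im_realM _ _))
  (fun x x01 => congr1 (@complex.Im R) (edge_x x x01)).
have [Rm Im_m] := (cvg_complexP _ _ _).1 E0m.
have {}Rm : x `^ alpha * complex.Re (dx E (x, 0)) @[x --> 0^'+] --> complex.Re m.
  by apply: cvg_trans Rm; apply: near_eq_cvg; near=> x; rewrite Re_realM.
have {}Im_m : x `^ alpha * complex.Im (dx E (x, 0)) @[x --> 0^'+] --> complex.Im m.
  by apply: cvg_trans Im_m; apply: near_eq_cvg; near=> x; rewrite Im_realM.
have f00 : complex.Re (E (0, 0)) = 1 by rewrite EE1 ?E10 ?lexx ?ltr01.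
have eqs (x t : R) : 0 < x -> 0 < t -> x + t < 1 ->
    [/\ is_derive t 1 (fun s => complex.Re (E (x, s))) (complex.Re (dy E (x, t))),
        is_derive t 1 (fun s => complex.Re (dx E (x, s)))
         ((complex.Re (dx E (x, t)) + complex.Re (dy E (x, t))) / (2 * (1 - x - t)) +
          (complex.Re (dx E (x, t)) * complex.Re (dy E (x, t)) -
           complex.Im (dx E (x, t)) * complex.Im (dy E (x, t))) / complex.Re (E (x, t))),
        is_derive t 1 (fun s => complex.Im (dx E (x, s)))
         ((complex.Im (dx E (x, t)) + complex.Im (dy E (x, t))) / (2 * (1 - x - t)) +
          (complex.Im (dx E (x, t)) * complex.Re (dy E (x, t)) +
           complex.Re (dx E (x, t)) * complex.Im (dy E (x, t))) / complex.Re (E (x, t))),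
        complex.Re (K (x, t)) = t `^ a * complex.Re (dy E (x, t)) &
        complex.Im (K (x, t)) = t `^ a * complex.Im (dy E (x, t))].
  move=> x0 t0 xt; have pxt := pos _ _ x0 t0 xt.
  have r0 : 0 < 2 * (1 - x - t) by lra.
  have [zr zi] := ernst_solve_xy (Re0 _ (posD_sub pxt)) r0 (eqE _ pxt).
  split.
  - exact: is_derive_Re (dEy _ pxt).
  - by rewrite -zr; exact: is_derive_Re (dExy _ pxt).
  - by rewrite -zi; exact: is_derive_Im (dExy _ pxt).
  - by rewrite KE// Re_realM.
  - by rewrite KE// Im_realM.
have Gth t : 0 < t < y -> complex.Im (K (0, t)) / complex.Re (E (0, t)) = t `^ a * dth t.
  by move=> /andP[t0 ty]; apply: kE; rewrite t0 (lt_trans ty).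
have [limR limI] := @ernst_edge_limit_real R alpha a y
  (fun p => complex.Re (E p)) (fun p => complex.Re (dx E p))
  (fun p => complex.Im (dx E p)) (fun p => complex.Re (dy E p))
  (fun p => complex.Im (dy E p)) (fun p => complex.Re (K p))
  (fun p => complex.Im (K p)) (phase E1) dth (complex.Re m) (complex.Im m)
  al0 a1 y01 cRe Re0 cReK cImK f00 eqs fx0 gx0 Rm Im_m th0 cth dth_ Gth.
rewrite -EE1; last by rewrite ltW.
rewrite -mulrA -fmorphV -rmorphM.
apply/cvg_complexP; split.
  have -> : complex.Re (m * (expi (phase E1 y) *
      (complex.Re (E (0, y)) / Num.sqrt (1 - y))%:C)) =
      (complex.Re m * cos (phase E1 y) - complex.Im m * sin (phase E1 y)) *
      (complex.Re (E (0, y)) / Num.sqrt (1 - y)).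
    by rewrite mulrA ReMreal; case: (m).
  by apply: cvg_trans limR; apply: near_eq_cvg; near=> x; rewrite Re_realM.
have -> : complex.Im (m * (expi (phase E1 y) *
    (complex.Re (E (0, y)) / Num.sqrt (1 - y))%:C)) =
    (complex.Re m * sin (phase E1 y) + complex.Im m * cos (phase E1 y)) *
    (complex.Re (E (0, y)) / Num.sqrt (1 - y)).
  by rewrite mulrA ImMreal; case: (m).
by apply: cvg_trans limI; apply: near_eq_cvg; near=> x; rewrite Im_realM.
Unshelve. all: by end_near. Qed.

Lemma cvg_normc_scaled (alpha c : R) (u : R -> R[i]) (m : R[i]) (s : R) :
  0 <= c ->
  (x `^ alpha)%:C * u x @[x --> 0^'+] --> m * (expi s * c%:C) ->
  x `^ alpha * Normc.normc (u x) @[x --> 0^'+] --> Normc.normc m * c.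
Proof.
move=> c0 /cvg_normc; rewrite !Normc.normcM normc_expi mul1r normc_real//.
apply: cvg_trans; apply: near_eq_cvg; near=> x.
by rewrite Normc.normcM normc_real ?powR_ge0.
Unshelve. all: by end_near. Qed.

End EdgeLimit.

Theorem theorem4 (R : realType) (alpha : R) (n : nat)
    (E0 E1 : R -> R[i]) (E : R * R -> R[i]) (m1 m2 : R[i]) :
  0 < alpha < 1 -> (2 <= n)%N ->
  is_goursat_datum n alpha E0 -> is_goursat_datum n alpha E1 ->
  is_goursat_solution n E0 E1 E ->
  (x `^ alpha)%:C * cderive E0 x @[x --> 0^'+] --> m1 ->
  (y `^ alpha)%:C * cderive E1 y @[y --> 0^'+] --> m2 ->
  [/\ forall y : R, 0 <= y < 1 ->
        (x `^ alpha)%:C * dx E (x, y) @[x --> 0^'+] -->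
          m1 * (expi (phase E1 y) * (complex.Re (E1 y))%:C
                  / (Num.sqrt (1 - y))%:C),
      forall x : R, 0 <= x < 1 ->
        (y `^ alpha)%:C * dy E (x, y) @[y --> 0^'+] -->
          m2 * (expi (phase E0 x) * (complex.Re (E0 x))%:C
                  / (Num.sqrt (1 - x))%:C),
      forall y : R, 0 <= y < 1 ->
        x `^ alpha * Normc.normc (dx E (x, y)) @[x --> 0^'+] -->
          Normc.normc m1 * (complex.Re (E1 y) / Num.sqrt (1 - y)) &
      forall x : R, 0 <= x < 1 ->
        y `^ alpha * Normc.normc (dy E (x, y)) @[y --> 0^'+] -->
          Normc.normc m2 * (complex.Re (E0 x) / Num.sqrt (1 - x))].
Proof.
move=> /andP[al0 _] n2 dE0 dE1 sE E0m E1m.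
have [a [/andP[_ a1] rE rSE]] := goursat_regular n2 sE.
have Ex := goursat_x_axis sE; have Ey := goursat_y_axis sE.
have limx y (y01 : 0 <= y < 1) :=
  ernst_edge_limit al0 a1 rE Ex Ey (datum0 dE1) E0m y01.
(* For [E \o swap] the data change places, and its [dx] at (y, x) is by conversion [dy E (x, y)]. *)
have limy x (x01 : 0 <= x < 1) :=
  ernst_edge_limit al0 a1 rSE Ey Ex (datum0 dE0) E1m x01.
have Re_ge0 (f : R -> R[i]) t : is_goursat_datum n alpha f -> 0 <= t < 1 ->
    0 <= complex.Re (f t) / Num.sqrt (1 - t).
  by move=> df t01; rewrite divr_ge0 ?sqrtr_ge0// ltW// (datum_Re_gt0 df).
split.
- exact: limx.
- exact: limy.
- move=> y y01; apply: (cvg_normc_scaled (s := phase E1 y)); first exact: Re_ge0.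
  by rewrite rmorphM fmorphV [expi _ * _]mulrA; exact: limx.
- move=> x x01; apply: (cvg_normc_scaled (s := phase E0 x)); first exact: Re_ge0.
  by rewrite rmorphM fmorphV [expi _ * _]mulrA; exact: limy.
Qed.
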